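(* Let $m\in\{2,3\}$, let $\mu\in\mathbb R^{|\mathcal E|}$ be a constant vector of mismatches, and let $\mathcal Z$ be a desired infinitesimally and minimally rigid shape. For $\kappa>0$ consider the autonomous system $$\dot v=-v-\overline BD_ze-\overline S_1D_z(\mu-\hat\mu),\qquad \dot z=\overline B^Tv,\qquad \dot e=2D_z^T\overline B^Tv,\qquad \dot{\hat\mu}_k=\kappa\,(e_k+\mu_k-\hat\mu_k),\quad k\in\{1,\dots,|\mathcal E|\},$$ where $e_k=\|z_k\|^2-d_k^2$. Assume that for $z^*\in\mathcal Z$ the matrix $$F=\begin{bmatrix}-\overline I_{|\mathcal V|}&-\overline S_2D_{z^*}\\ 2D_{z^*}^T\overline B^T&\mathbf 0\end{bmatrix}$$ is Hurwitz. Then there exists a positive constant $\kappa^*$ such that for all $\kappa>\kappa^*>0$ the equilibrium corresponding to $\hat\mu=\mu$, $v=\mathbf 0$ and $e=\mathbf 0$ (with $z^*\in\mathcal Z$) is locally exponentially stable.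
   Context: Notation. $n\ge2$ agents have positions $p_i\in\mathbb R^m$ and velocities $v_i\in\mathbb R^m$; $p,v\in\mathbb R^{mn}$ are the stacked vectors, $\dot p=v$, and $z=\overline B^Tp$. For a matrix $A$, $\overline A=A\otimes I_m$ (Kronecker product); in particular $\overline I_{|\mathcal V|}$ is the $m|\mathcal V|\times m|\mathcal V|$ identity. For a stacked vector $x=[x_1^T\dots x_k^T]^T$ with blocks $x_i\in\mathbb R^m$, $D_x=\operatorname{diag}\{x_i\}$ is the $km\times k$ block-diagonal matrix with the column blocks $x_i$. A matrix is Hurwitz if all its eigenvalues have negative real part. Graph. The sensing topology is an undirected graph $\mathbb G=(\mathcal V,\mathcal E)$, $\mathcal V=\{1,\dots,n\}$, whose edges are ordered and written $\mathcal E_k=(\mathcal E_k^{\rm tail},\mathcal E_k^{\rm head})$. The incidence matrix $B\in\mathbb R^{|\mathcal V|\times|\mathcal E|}$ has $b_{ik}=1$ if $i=\mathcal E_k^{\rm tail}$, $b_{ik}=-1$ if $i=\mathcal E_k^{\rm head}$, and $0$ otherwise. $S_1$ is obtained from $B$ by setting its $-1$ entries to $0$, and $S_2=B-S_1$. $z_k=p_i-p_j$ for $\mathcal E_k=(i,j)$. Rigidity. The rigidity matrix is $R(z)=D_z^T\overline B^T$. A framework $(\mathbb G,p)$ is infinitesimally and minimally rigid if $\operatorname{rank}R(z)=|\mathcal E|=2n-3$ (for $m=2$) or $\operatorname{rank}R(z)=|\mathcal E|=3n-6$ (for $m=3$). Given the desired relative positions $z^*$ of such a framework, $\mathcal Z=\{(I_{|\mathcal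 E|}\otimes \mathcal R)z^*:\mathcal R\in SO(m)\}$ and $d_k=\|z^*_k\|$. (Hurwitzness of $F$ does not depend on the choice of $z^*\in\mathcal Z$.) $\hat\mu\in\mathbb R^{|\mathcal E|}$ is the estimator state; $\mu_k$ is the constant discrepancy between the squared desired distances used by the two agents of edge $\mathcal E_k$ (the head agent uses $d_k^2$, the tail agent $d_k^2-\mu_k$). Since the equilibria form the continuum $z\in\mathcal Z$, local exponential stability means: for initial data with $v(0)$, $\hat\mu(0)-\mu$ sufficiently small and $z(0)$ sufficiently close to $\mathcal Z$, the vector $(v(t),e(t),\hat\mu(t)-\mu)$ is bounded by $C e^{-ct}\,\|(v(0),e(0),\hat\mu(0)-\mu)\|$ for some constants $C,c>0$, and $z(t)$ converges to $\mathcal Z$ exponentially. *)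

(* Defs.v *)
From HB Require Import structures.
From mathcomp Require Import all_boot all_order all_algebra.
From mathcomp Require Import all_classical all_reals all_analysis.
From mathcomp Require Import complex mxtens.

Set Implicit Arguments.
Unset Strict Implicit.
Unset Printing Implicit Defensive.

Import Order.TTheory GRing.Theory Num.Theory numFieldNormedType.Exports.

Local Open Scope classical_set_scope.
Local Open Scope ring_scope.

(* A finite simple undirected graph on 'I_n with nE numbered edges.  The
   orientation (edge k).1 -> (edge k).2 of edge k is arbitrary, but two edges
   never join the same unordered pair of vertices. *)
Record graph (n nE : nat) := Graph {
  edge :> 'I_nE -> 'I_n * 'I_n;
  _ : forall k, (edge k).1 != (edge k).2;
  _ : injective (fun k => [set (edge k).1; (edge k).2]%SET)
}.

Definition etail n nE (G : graph n nE) (k : 'I_nE) : 'I_n := (G k).1.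
Definition ehead n nE (G : graph n nE) (k : 'I_nE) : 'I_n := (G k).2.

Section Matrices.
Variable R : realType.

Definition enorm (k : nat) (x : 'cV[R]_k) : R :=
  Num.sqrt (\sum_(i < k) x i ord0 ^+ 2).

(* A stacked vector of k blocks of size m is a 'cV_(k * m), indexed in the same
   way as the rows of a Kronecker product A *t B. *)
Definition blk (k m : nat) (x : 'cV[R]_(k * m)) (i : 'I_k) : 'cV[R]_m :=
  \col_(j < m) x (mxtens_index (i, j)) ord0.

Definition Dmx (k m : nat) (x : 'cV[R]_(k * m)) : 'M[R]_(k * m, k) :=
  \matrix_(r < k * m, c < k)
    (if (mxtens_unindex r).1 == c
     then blk x c (mxtens_unindex r).2 ord0 else 0).

Definition ovl (m r s : nat) (A : 'M[R]_(r, s)) : 'M[R]_(r * m, s * m) :=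
  tensmx A (1%:M : 'M[R]_m).

Definition hurwitz (N : nat) (A : 'M[R]_N) : Prop :=
  forall l : complex R,
    eigenvalue (map_mx (real_complex R) A) l -> complex.Re l < 0.

Definition special_orth (m : nat) : set 'M[R]_m :=
  [set Q | Q *m Q^T = 1%:M /\ \det Q = 1].

Section Graph.
Variables (n nE : nat) (G : graph n nE).

Definition incidence : 'M[R]_(n, nE) :=
  \matrix_(i < n, k < nE)
    (if i == etail G k then 1 else if i == ehead G k then -1 else 0).

Definition S1mx : 'M[R]_(n, nE) :=
  \matrix_(i < n, k < nE)
    (if incidence i k == -1 then 0 else incidence i k).

Definition S2mx : 'M[R]_(n, nE) := incidence - S1mx.

Variable m : nat.

Definition relpos (p : 'cV[R]_(n * m)) : 'cV[R]_(nE * m) :=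
  (ovl m incidence)^T *m p.

Definition rigidity (z : 'cV[R]_(nE * m)) : 'M[R]_(nE, n * m) :=
  (Dmx z)^T *m (ovl m incidence)^T.

Definition inf_min_rigid (p : 'cV[R]_(n * m)) : Prop :=
  (m = 2%N /\ \rank (rigidity (relpos p)) = nE /\ nE = (2 * n - 3)%N) \/
  (m = 3%N /\ \rank (rigidity (relpos p)) = nE /\ nE = (3 * n - 6)%N).

Definition desired_shape (zs : 'cV[R]_(nE * m)) : set 'cV[R]_(nE * m) :=
  [set z | exists2 Q, special_orth Q & z = tensmx (1%:M : 'M[R]_nE) Q *m zs].

Definition Fmx (zs : 'cV[R]_(nE * m)) : 'M[R]_(n * m + nE) :=
  block_mx (- 1%:M)                          (- (ovl m S2mx *m Dmx zs))
           (2 *: ((Dmx zs)^T *m (ovl m incidence)^T)) 0.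

(* e_k = ||z_k||^2 - d_k^2 with d_k = ||zs_k||. *)
Definition err (zs z : 'cV[R]_(nE * m)) : 'cV[R]_nE :=
  \col_(k < nE) (enorm (blk z k) ^+ 2 - enorm (blk zs k) ^+ 2).

(* Solutions of the closed loop on [0, T[, where T may be +oo.  At t = 0 only
   right-continuity is asked, the equations holding on ]0, T[.  Since
   z = relpos p for positions p, the initial z lies in the range of relpos. *)
Definition is_solution (zs : 'cV[R]_(nE * m)) (mu : 'cV[R]_nE) (kappa : R)
    (T : \bar R) (v : R -> 'cV[R]_(n * m)) (z : R -> 'cV[R]_(nE * m))
    (e muh : R -> 'cV[R]_nE) : Prop :=
  [/\ (exists p0, z 0 = relpos p0),
      (forall t : R, 0 <= t -> (t%:E < T)%E -> e t = err zs (z t)),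
      [/\ v t @[t --> 0^'+] --> v 0,
          z t @[t --> 0^'+] --> z 0 &
          muh t @[t --> 0^'+] --> muh 0] &
      forall t : R, 0 < t -> (t%:E < T)%E ->
      [/\ is_derive t 1 v
            (- v t - ovl m incidence *m Dmx (z t) *m e t
             - ovl m S1mx *m Dmx (z t) *m (mu - muh t)),
          is_derive t 1 z ((ovl m incidence)^T *m v t),
          is_derive t 1 e
            (2 *: ((Dmx (z t))^T *m (ovl m incidence)^T *m v t)) &
          forall k : 'I_nE, is_derive t 1 (fun s => muh s k ord0)
            (kappa * (e t k ord0 + mu k ord0 - muh t k ord0))]].

(* Local exponential stability of the continuum of equilibria
   { v = 0, muh = mu, z \in desired_shape zs } (on which e = 0): admissible initial data
   close to it have a solution on [0, +oo[, and every solution from them, on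
   whatever interval [0, T[, decays with constants C and c that do not depend on
   the initial data.  As desired_shape zs is compact, distances to it are attained. *)
Definition loc_exp_stable (zs : 'cV[R]_(nE * m)) (mu : 'cV[R]_nE) (kappa : R) :
    Prop :=
  exists delta C c : R,
    [/\ 0 < delta, 0 < C, 0 < c &
    forall (v0 : 'cV[R]_(n * m)) (p0 : 'cV[R]_(n * m)) (muh0 : 'cV[R]_nE),
      enorm v0 < delta -> enorm (muh0 - mu) < delta ->
      (exists2 w, desired_shape zs w & enorm (relpos p0 - w) < delta) ->
      (exists v z e muh, is_solution zs mu kappa +oo%E v z e muh /\
         [/\ v 0 = v0, z 0 = relpos p0 & muh 0 = muh0]) /\
      (forall (T : \bar R) v z e muh, is_solution zs mu kappa T v z e muh ->
         [/\ v 0 = v0, z 0 = relpos p0 & muh 0 = muh0] ->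
         forall t : R, 0 <= t -> (t%:E < T)%E ->
           enorm (col_mx (v t) (col_mx (e t) (muh t - mu))) <=
             C * expR (- c * t) *
             enorm (col_mx (v 0) (col_mx (e 0) (muh 0 - mu))) /\
           exists2 w, desired_shape zs w & enorm (z t - w) <= C * expR (- c * t))].

End Graph.
End Matrices.

(* Main.v *)
Require Import Defs.
From HB Require Import structures.
From mathcomp Require Import all_boot all_order all_algebra.
From mathcomp Require Import all_classical all_reals all_analysis.
From mathcomp Require Import complex mxtens ring lra zify.

Set Implicit Arguments.
Unset Strict Implicit.
Unset Printing Implicit Defensive.

Import Order.TTheory GRing.Theory Num.Theory numFieldNormedType.Exports.

Local Open Scope classical_set_scope.
Local Open Scope ring_scope.

(** Write w = muh - mu for the estimation error and y = w - e for its distance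
    to the fast manifold muh = mu + e.  In the coordinates (v, e, y) the closed
    loop is x' = F x + r with x = (v, e) and y' = - kappa y - e': F is the
    matrix of the system in which the estimator has reached its quasi-steady
    state w = e, and the perturbation r is bounded by small |x| + const |y| as
    long as z stays close to a point zs of the shape.  Since F is Hurwitz it has
    a quadratic Lyapunov form P (lemma lyapunov: Schur triangularization over
    the complex numbers, with geometric weights that make the diagonal
    dominate).  The function V = x^T P x + |y|^2 then decreases exponentially
    once kappa dominates the cross terms (lemma lyap_estimate), and this is
    what defines the gain threshold.

    The estimate holds only near zs, and zs is not isolated: the equilibria form
    a whole SO(m)-orbit, along which V does not measure z.  But z' = B^T v is
    exponentially small, so the total displacement of z is controlled by the
    initial error, and a continuity argument traps the trajectory near zs
    (theorem trapped).  The system commutes with SO(m), so a trajectory that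
    starts near any other point of the orbit is rotated to one that starts near
    zs.

    Exponential convergence of z to the orbit follows from that of e and from
    the rigidity of the framework (lemma shape_dist).  Counting dimensions, the
    kernel of the rigidity matrix consists of the infinitesimal rotations and
    translations only (theorem rigid_kernel).  If Q is the rotation for which
    Q zs is closest to z, optimality makes the difference d = Q^T z - zs
    orthogonal to the infinitesimal rotations of zs; on that complement the
    rigidity matrix is injective, and |d| <= K |e| for z close to the orbit.

    Finally, solutions exist for all times: the vector field, composed with a
    truncation of the state to a neighbourhood of the equilibrium, is bounded
    and globally Lipschitz, hence has global integral curves (theorem picard),
    and the trapping argument shows that these never leave the region where the
    truncation is the identity. *)

(** * Differential inequalities and antiderivatives *)

Section Calculus.
Variable R : realType.

Lemma is_derive_mxP (m n : nat) (M : R -> 'M[R]_(m, n)) (t : R) (D : 'M[R]_(m, n)) :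
  is_derive t 1 M D <-> forall i j, is_derive t 1 (fun s => M s i j) (D i j).
Proof.
split=> [dM i j|dM].
  have dvM : derivable M t 1 by [].
  have dv : derivable (fun s => M s i j) t 1.
    exact: ((derivable_mxP M t 1).1 dvM i j).
  apply: DeriveDef => //.
  by rewrite -(@derive_val _ _ _ _ _ _ _ dM) derive_mx// mxE.
have dvM : derivable M t 1.
  by apply: (derivable_mxP M t 1).2 => i j; case: (dM i j).
apply: DeriveDef => //.
rewrite derive_mx//; apply/matrixP => i j; rewrite mxE.
exact: (@derive_val _ _ _ _ _ _ _ (dM i j)).
Qed.

Lemma is_derive_continuous (V : normedModType R) (f : R -> V) (t : R) (df : V) :
  is_derive t 1 f df -> {for t, continuous f}.
Proof.
move=> [df1 _]; apply/differentiable_continuous.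
exact/derivable1_diffP.
Qed.

(** The one-sided hypothesis at the left end is what solutions offer at their
    initial time, where they are only right-continuous. *)
Lemma derive_le0_end (f df : R -> R) (a b : R) :
  a <= b -> f x @[x --> a^'+] --> f a ->
  (forall t, a < t <= b -> is_derive t 1 f (df t)) ->
  (forall t, a < t <= b -> df t <= 0) -> f b <= f a.
Proof.
rewrite le_eqVlt => /predU1P[->//|ab] fa fd dle.
have cf : {within `[a, b], continuous f}.
  apply/continuous_within_itvP => //; split => //.
    move=> x; rewrite in_itv/= => /andP[ax xb].
    by apply: (is_derive_continuous (df := df x)); apply: fd; rewrite ax ltW.
  have : f x @[x --> b] --> f b.
    by apply: (is_derive_continuous (df := df b)); apply: fd; rewrite ab lexx.
  exact: cvg_at_left_filter.
have fd' x : x \in `]a, b[ -> is_derive x 1 f (df x).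
  by rewrite in_itv/= => /andP[ax xb]; apply: fd; rewrite ax ltW.
have [c] := MVT ab fd' cf.
rewrite in_itv/= => /andP[ac cb] e.
rewrite -subr_le0 e mulr_le0_ge0 ?subr_ge0 ?(ltW ab)//.
by apply: dle; rewrite ac ltW.
Qed.

Lemma derive_dist_end (f df h dh : R -> R) (a b : R) :
  a <= b -> f x @[x --> a^'+] --> f a -> h x @[x --> a^'+] --> h a ->
  (forall t, a < t <= b -> is_derive t 1 f (df t)) ->
  (forall t, a < t <= b -> is_derive t 1 h (dh t)) ->
  (forall t, a < t <= b -> `|df t| <= dh t) -> `|f b - f a| <= h b - h a.
Proof.
move=> ab fa ha fd hd dle; rewrite ler_norml; apply/andP; split.
- have : (- f - h) b <= (- f - h) a.
    apply: (@derive_le0_end _ (fun t => - df t - dh t)) => //.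
    - by apply: cvgB => //; exact: cvgN.
    - by move=> t tab; have := fd t tab; have := hd t tab => ? ?; exact: is_deriveB.
    - by move=> t tab; have := dle t tab; rewrite ler_norml => /andP[]; lra.
  rewrite -![(_ - _ : _ -> _) _]/(_ - _) -![(- _ : _ -> _) _]/(- _); lra.
- have : (f - h) b <= (f - h) a.
    apply: (@derive_le0_end _ (fun t => df t - dh t)) => //.
    - by apply: cvgB => //; exact: cvgN.
    - by move=> t tab; have := fd t tab; have := hd t tab => ? ?; exact: is_deriveB.
    - by move=> t tab; have := dle t tab; rewrite ler_norml => /andP[]; lra.
  rewrite -![(_ - _ : _ -> _) _]/(_ - _); lra.
Qed.

Lemma is_derive_expRZ (K c t : R) :
  is_derive t 1 (fun s => K * expR (c * s)) (K * c * expR (c * t)).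
Proof.
have h1 : is_derive t 1 (fun s : R => c * s) c.
  have := is_deriveZ (f := id) c (is_derive_id t (1:R)).
  by rewrite [c *: (1 : R)]mulr1.
have h2 : is_derive t 1 (expR \o (fun s : R => c * s)) (c * expR (c * t)).
  rewrite mulrC; exact: (is_derive1_comp (is_derive_expR _) h1).
have := is_deriveZ K h2; rewrite /GRing.scale/= mulrA => h3; exact: h3.
Qed.

Lemma cvg_expRZ (K c : R) (t : R) : K * expR (c * x) @[x --> t^'+] --> K * expR (c * t).
Proof.
apply: cvg_at_right_filter.
exact: (is_derive_continuous (is_derive_expRZ K c t)).
Qed.

(** The function g exp (c t) is nonincreasing. *)
Lemma gronwall (g dg : R -> R) (c b : R) :
  0 <= b -> g x @[x --> 0^'+] --> g 0 ->
  (forall t, 0 < t <= b -> is_derive t 1 g (dg t)) ->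
  (forall t, 0 < t <= b -> dg t <= - c * g t) -> g b <= g 0 * expR (- c * b).
Proof.
move=> b0 g0 gd dle.
pose h s := g s * (1 * expR (c * s)).
have : h b <= h 0.
  apply: (@derive_le0_end _ (fun t => g t * (1 * c * expR (c * t)) + (1 * expR (c * t)) * dg t)) => //.
  - by apply: cvgM => //; exact: cvg_expRZ.
  - move=> t tb; have := gd t tb => ?.
    have h2 := @is_deriveM R R^o g (fun s => 1 * expR (c * s)) t 1 _ _ _ (is_derive_expRZ 1 c t).
    exact: h2.
  - move=> t tb; have := dle t tb => H.
    have E := expR_gt0 (c * t); rewrite !mul1r; nra.
rewrite /h !mul1r mulr0 expR0 mulr1 mulNr => H.
by rewrite expRN ler_pdivlMr ?expR_gt0.
Qed.

(** Only times t >= 0 matter; the integral starts from -1 so that the derivative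
    at 0 is two-sided. *)
Lemma antiderivative (g : R -> R) : continuous g ->
  exists G : R -> R, G 0 = 0 /\ forall t : R, -1 < t -> is_derive t 1 G (g t).
Proof.
move=> cg.
pose F (x : R) := (\int[lebesgue_measure]_(t in [set` `[(-1 : R), x]]) (g t))%R.
have dF (t : R) : -1 < t -> is_derive t 1 F (g t).
  move=> t1.
  have tu : t < t + 1 by rewrite ltrDl.
  have ig : lebesgue_measure.-integrable `[(-1:R), t + 1] (EFin \o g).
    apply: continuous_compact_integrable; first exact: segment_compact.
    exact: continuous_subspaceT.
  have [] := @continuous_FTC1_closed R g (-1) t (t + 1) tu ig t1 (cg t).
  move=> dF1 dF2; apply: DeriveDef; first exact: dF1.
  by rewrite -derive1E; exact: dF2.
exists (fun x => F x - F 0); split; first by rewrite subrr.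
move=> t t1; rewrite -[g t]subr0.
exact: (@is_deriveB _ _ _ _ _ _ _ _ _ (dF t t1) (is_derive_cst (F 0) t 1)).
Qed.

Lemma cv_antiderivative (N : nat) (g : R -> 'cV[R]_N) : continuous g ->
  exists G : R -> 'cV[R]_N,
    G 0 = 0 /\ forall t : R, -1 < t -> is_derive t 1 G (g t).
Proof.
move=> cg.
have cgi i : continuous (fun t => g t i ord0).
  move=> t; apply: (@continuous_comp _ _ _ g (fun M : 'cV[R]_N => M i ord0)).
    exact: cg.
  exact: coord_continuous.
have /choice[G GP] : forall i : 'I_N, exists G : R -> R, G 0 = 0 /\
    forall t : R, -1 < t -> is_derive t 1 G (g t i ord0).
  by move=> i; apply: antiderivative; exact: cgi.
exists (fun t => \col_i G i t); split.
  by apply/colP => i; rewrite !mxE; exact: (GP i).1.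
move=> t t1; apply/is_derive_mxP => i j; rewrite (ord1 j).
have -> : (fun s => (\col_i0 G i0 s) i ord0) = G i.
  by apply/funext => s; rewrite mxE.
exact: (GP i).2.
Qed.

Lemma mx_norm_leP (m n : nat) (x : 'M[R]_(m, n)) (e : R) : 0 <= e ->
  (`|x| <= e) <-> (forall i j, `|x i j| <= e).
Proof.
move=> e0; rewrite [leLHS]/Num.Def.normr/= mx_normrE; split=> [H i j|H].
  by apply: le_trans H; exact: (le_bigmax _ (fun i : 'I_m * 'I_n => `|x i.1 i.2|) (i, j)).
by apply/bigmax_leP; split.
Qed.

Lemma le_mx_norm (m n : nat) (x : 'M[R]_(m, n)) i j : `|x i j| <= `|x|.
Proof. exact: ((@mx_norm_leP m n x `|x| (normr_ge0 x)).1 (lexx _) i j). Qed.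

(** Lets an estimate on the iterates of a geometrically convergent sequence pass
    to the limit. *)
Lemma le_geometric_eps (a b c : R) :
  (forall k, a <= b + c * 2^-1 ^+ k) -> a <= b.
Proof.
move=> H.
have cv : (b + c * 2^-1 ^+ k) @[k --> \oo] --> b + c * 0.
  apply: cvgD; first exact: cvg_cst.
  apply: cvgM; first exact: cvg_cst.
  by apply: cvg_expr; rewrite ger0_norm ?invf_lt1// ?ltr1n ?invr_ge0.
rewrite mulr0 addr0 in cv.
rewrite -(cvg_lim (@Rhausdorff R) cv).
by apply: limr_ge; [apply: cvgP cv|exact: nearW].
Qed.

(** The sequences u k +- 2 C / 2^k are monotone and enclose the limit, which gives
    convergence together with its rate. *)
Lemma geometric_limit (u : nat -> R) (C : R) :
  (forall k, `|u k.+1 - u k| <= C * 2^-1 ^+ k) ->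
  exists l, forall k, `|u k - l| <= 2 * C * 2^-1 ^+ k.
Proof.
move=> H.
have h k : (2^-1 ^+ k.+1 : R) = 2^-1 ^+ k / 2 by rewrite exprSr.
pose a k := u k + 2 * C * 2^-1 ^+ k.
pose b k := u k - 2 * C * 2^-1 ^+ k.
have C0 : 0 <= C by have := le_trans (normr_ge0 _) (H 0%N); rewrite expr0 mulr1.
have p0 k : 0 <= C * 2^-1 ^+ k by rewrite mulr_ge0// exprn_ge0// invr_ge0.
have aS k : a k.+1 <= a k.
  have := H k; rewrite /a h ler_norml => /andP[_]; lra.
have bS k : b k <= b k.+1.
  have := H k; rewrite /b h ler_norml => /andP[+ _]; lra.
have amono : nonincreasing_seq a by apply/nonincreasing_seqP.
have bmono : nondecreasing_seq b by apply/nondecreasing_seqP.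
have ba j k : b j <= a k.
  apply: (@le_trans _ _ (b (maxn j k))); first exact/bmono/leq_maxl.
  apply: (@le_trans _ _ (a (maxn j k))); last exact/amono/leq_maxr.
  by rewrite /a /b; have := p0 (maxn j k); lra.
have lb : has_lbound (range a) by exists (b 0%N) => _ [k _ <-]; exact: ba.
have cva := nonincreasing_is_cvgn amono lb.
exists (limn a) => k.
have h1 : limn a <= a k by exact: nonincreasing_cvgn_ge.
have h2 : b k <= limn a by apply: limr_ge => //; exact: nearW.
by rewrite ler_norml; move: h1 h2; rewrite /a /b => h1 h2; apply/andP; split; lra.
Qed.

End Calculus.

(** * Global integral curves of bounded Lipschitz vector fields *)

Section Picard.
Variables (R : realType) (N : nat).
Implicit Types X Y : R -> 'cV[R]_N.

Lemma cv_derive_dist_end (f df : R -> 'cV[R]_N) (h dh : R -> R) (a b : R) :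
  a <= b -> f x @[x --> a^'+] --> f a -> h x @[x --> a^'+] --> h a ->
  (forall t, a < t <= b -> is_derive t 1 f (df t)) ->
  (forall t, a < t <= b -> is_derive t 1 h (dh t)) ->
  (forall t, a < t <= b -> `|df t| <= dh t) -> `|f b - f a| <= h b - h a.
Proof.
move=> ab fa ha fd hd dle.
have main i j : `|(f b - f a) i j| <= h b - h a.
  rewrite !mxE.
  apply: (@derive_dist_end _ (fun t => f t i j) (fun t => df t i j) h dh) => //.
  - apply: (@cvg_comp _ _ _ f (fun M : 'cV[R]_N => M i j)); first exact: fa.
    exact: coord_continuous.
  - by move=> t tab; exact: ((is_derive_mxP f t (df t)).1 (fd t tab) i j).
  - by move=> t tab; apply: le_trans (dle t tab); exact: le_mx_norm.
have h0 : 0 <= h b - h a.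
  rewrite subr_ge0 -lerN2; change ((- h) b <= (- h) a).
  apply: (@derive_le0_end _ (- h) (fun t => - dh t)) => //.
  - exact: cvgN.
  - by move=> t tab; have := hd t tab => ?; exact: is_deriveN.
  - by move=> t tab; rewrite oppr_le0; apply: le_trans (dle t tab).
by apply/mx_norm_leP.
Qed.

(** Freezing the time below 0 makes a curve that is known to be continuous for
    t >= 0 only into a continuous one, which has an antiderivative. *)
Lemma continuous_lip_half (f : 'cV[R]_N -> 'cV[R]_N) (L : R) X :
  (forall x y, `|f x - f y| <= L * `|x - y|) ->
  (forall t : R, 0 <= t -> {for t, continuous X}) ->
  continuous (fun s : R => f (X (Num.max s 0))).
Proof.
move=> fL cX.
have cf : continuous f.
  move=> x; apply/(@cvgrPdist_le _ _ _ _ (nbhs_filter x)) => /= e e0.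
  have L0 : 0 < `|L| + 1 by rewrite ltr_wpDl.
  have := nbhsx_ballx x (e / (`|L| + 1)) (divr_gt0 e0 L0).
  apply: filterS => y; rewrite -ball_normE /ball_/= ltr_pdivlMr// => /ltW H.
  apply: le_trans (fL x y) _; apply: le_trans H.
  rewrite mulrC ler_wpM2l//; have := ler_norm L; lra.
move=> t; apply: (@continuous_comp _ _ _ (fun s : R => X (Num.max s 0)) f); last exact: cf.
apply: (@continuous_comp _ _ _ (fun s : R => Num.max s 0) X).
  by apply: continuous_max; [exact: cvg_id|exact: cvg_cst].
by apply: cX; rewrite le_max lexx orbT.
Qed.

(** Picard iteration.  In the weighted distance sup_t |X t - Y t| exp (- 2 L t) the
    integral operator halves distances on the whole half-line at once, so the
    iterates converge for all times and no local solutions have to be glued.  The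
    bound M makes all iterates M-Lipschitz, hence so is their limit, which is
    therefore continuous. *)
Theorem picard (f : 'cV[R]_N -> 'cV[R]_N) (L M : R) (x0 : 'cV[R]_N) :
  0 < L -> (forall x, `|f x| <= M) ->
  (forall x y, `|f x - f y| <= L * `|x - y|) ->
  exists X : R -> 'cV[R]_N,
    X 0 = x0 /\ forall t : R, 0 <= t -> is_derive t 1 X (f (X t)).
Proof.
move=> L0 fM fL.
pose good X := forall t : R, 0 <= t -> {for t, continuous X}.
pose sol X Y := Y 0 = x0 /\ forall t : R, 0 <= t -> is_derive t 1 Y (f (X t)).
have solP X : good X -> exists Y, sol X Y.
  move=> gX; have [G [G0 dG]] := cv_antiderivative (continuous_lip_half fL gX).
  exists (fun t => x0 + G t); split; first by rewrite G0 addr0.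
  move=> t t0; rewrite -[f _]add0r.
  have t1 : -1 < t by apply: lt_le_trans t0; lra.
  have := dG t t1; rewrite max_l// => dGt.
  exact: (@is_deriveD _ _ _ _ _ _ _ _ _ (is_derive_cst x0 t 1) dGt).
have solg X Y : sol X Y -> good Y.
  by move=> [_ dY] t t0; exact: (is_derive_continuous (dY t t0)).
have goodr X (t : R) : good X -> 0 <= t -> X s @[s --> t^'+] --> X t.
  by move=> gX t0; apply: cvg_at_right_filter; exact: gX.
have M0 : 0 <= M by apply: le_trans (fM x0).
have [Xs XsP] : exists Xs : nat -> R -> 'cV[R]_N,
    Xs 0%N = (fun=> x0) /\ forall k, sol (Xs k) (Xs k.+1).
  have /choice[F FP] : forall X, exists Y, good X -> sol X Y.
    move=> X; have [gX|ngX] := pselect (good X); last by exists X.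
    by have [Y XY] := solP X gX; exists Y.
  exists (fun k => iter k F (fun=> x0)); split => // k.
  suff gk : good (iter k F (fun=> x0)) by exact: FP.
  elim: k => [|k IH]; first by move=> t _; exact: cvg_cst.
  exact: solg (FP _ IH).
have Xg k : good (Xs k).
  case: k => [|k]; last exact: solg (XsP.2 k).
  by rewrite XsP.1 => t _; exact: cvg_cst.
have Xs0 k : Xs k 0 = x0 by case: k => [|k]; [rewrite XsP.1|case: (XsP.2 k)].
have solM X Y (s t : R) : sol X Y -> 0 <= s <= t -> `|Y t - Y s| <= M * t - M * s.
  move=> XY /andP[s0 st].
  apply: (@cv_derive_dist_end Y (fun t => f (X t)) (fun t => M * t) (fun=> M)) => //.
  - by apply: goodr => //; exact: solg XY.
  - by apply: cvg_at_right_filter; exact: mulrl_continuous.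
  - by move=> u /andP[su ut]; apply: XY.2; exact: le_trans (ltW su).
  - move=> u _; have := is_deriveZ (f := id) M (is_derive_id u (1:R)).
    by rewrite [M *: (1 : R)]mulr1.
(* the distance of the first two iterates is at most M t <= C exp (2 L t) *)
pose C := M / (2 * L).
have E0 t : 0 < expR (2 * L * t) by exact: expR_gt0.
have LC : 2 * L * C = M by rewrite /C; field; lra.
have C0 : 0 <= C by rewrite /C divr_ge0// mulr_ge0// ltW.
have solD X Y X' Y' (K : R) : sol X Y -> sol X' Y' ->
    (forall t : R, 0 <= t -> `|X t - X' t| <= K * expR (2 * L * t)) ->
    forall t : R, 0 <= t -> `|Y t - Y' t| <= K / 2 * expR (2 * L * t).
  move=> XY XY' H t t0.
  have : `|(Y t - Y' t) - (Y 0 - Y' 0)| <=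
      K / 2 * expR (2 * L * t) - K / 2 * expR (2 * L * 0).
    apply: (@cv_derive_dist_end (fun t => Y t - Y' t)
      (fun t => f (X t) - f (X' t)) (fun t => K / 2 * expR (2 * L * t))
      (fun t => K / 2 * (2 * L) * expR (2 * L * t))) => //.
    - apply: cvgB; apply: goodr => //; [exact: solg XY|exact: solg XY'].
    - exact: cvg_expRZ.
    - move=> u /andP[u0 _]; have := XY.2 u (ltW u0) => ?.
      by have := XY'.2 u (ltW u0) => ?; exact: is_deriveB.
    - by move=> u _; exact: is_derive_expRZ.
    - move=> u /andP[u0 _]; apply: le_trans (fL _ _) _.
      have := H u (ltW u0); nra.
  rewrite XY.1 XY'.1 subrr subr0 mulr0 expR0 mulr1 => H1.
  have K0 : 0 <= K.
    have := H 0 (lexx _); rewrite mulr0 expR0 mulr1; exact: le_trans.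
  lra.
have step k : forall t : R, 0 <= t ->
    `|Xs k.+1 t - Xs k t| <= C * 2^-1 ^+ k * expR (2 * L * t).
  elim: k => [|k IH] t t0.
    rewrite XsP.1 expr0 mulr1 -(Xs0 1%N).
    apply: le_trans (solM _ _ 0 t (XsP.2 0%N) _) _; first by rewrite lexx.
    rewrite mulr0 subr0 -LC.
    have := expR_ge1Dx (2 * L * t); nra.
  have := solD _ _ _ _ _ (XsP.2 k.+1) (XsP.2 k) IH t t0.
  by rewrite exprSr mulrA.
have /choice[X XP] : forall t : R, exists x : 'cV[R]_N, 0 <= t -> forall k,
    `|Xs k t - x| <= 2 * C * 2^-1 ^+ k * expR (2 * L * t).
  move=> t; have [t0|] := leP 0 t; last by exists x0.
  have /choice[x xP] : forall i : 'I_N, exists l : R, forall k,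
      `|Xs k t i ord0 - l| <= 2 * (C * expR (2 * L * t)) * 2^-1 ^+ k.
    move=> i; apply: geometric_limit => k.
    have := le_trans (le_mx_norm (Xs k.+1 t - Xs k t) i ord0) (step k t t0).
    by rewrite !mxE mulrAC.
  exists (\col_i x i) => _ k; apply/mx_norm_leP.
    by apply: mulr_ge0 (ltW (E0 t)); apply: mulr_ge0; [exact: mulr_ge0|rewrite exprn_ge0 ?invr_ge0].
  move=> i j; rewrite !mxE (ord1 j) [leRHS](_ : _ = 2 * (C * expR (2 * L * t)) * 2^-1 ^+ k)//; ring.
have Xlip s t : 0 <= s <= t -> `|X t - X s| <= M * t - M * s.
  move=> st; have /andP[s0 st'] := st; have t0 := le_trans s0 st'.
  apply: (@le_geometric_eps _ _ _ (2 * C * (expR (2 * L * t) + expR (2 * L * s)))).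
  move=> k.
  have h : X t - X s = (Xs k.+1 t - Xs k.+1 s) - (Xs k.+1 t - X t) + (Xs k.+1 s - X s).
    by rewrite !opprD !opprK; apply/colP => i; rewrite !mxE; ring.
  rewrite h; apply: le_trans (ler_normD _ _) _.
  have := ler_normB (Xs k.+1 t - Xs k.+1 s) (Xs k.+1 t - X t).
  have := solM _ _ _ _ (XsP.2 k) st.
  have := XP t t0 k.+1; have := XP s s0 k.+1.
  have p0 : 0 <= 2^-1 ^+ k :> R by rewrite exprn_ge0 ?invr_ge0.
  have := E0 t; have := E0 s.
  rewrite exprSr; set e := 2^-1 ^+ k in p0 *.
  move: (expR (2 * L * s)) (expR (2 * L * t)) => es et.
  move=> es0 et0 H1 H2 H3 H4.
  have Ce : 0 <= C * e by exact: mulr_ge0.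
  have := mulr_ge0 Ce (ltW es0); have := mulr_ge0 Ce (ltW et0).
  nra.
have Xlip' s t : 0 <= s -> 0 <= t -> `|X t - X s| <= M * `|t - s|.
  move=> s0 t0; have [st|ts] := leP s t.
    by rewrite ger0_norm ?subr_ge0// mulrBr Xlip// s0.
  by rewrite distrC [`|t - s|]distrC gtr0_norm ?subr_gt0// mulrBr Xlip// t0 ltW.
have XgM : continuous (fun s : R => X (Num.max s 0)).
  move=> t; apply/cvgrPdist_le => /= e e0.
  have M1 : 0 < M + 1 by lra.
  have := nbhsx_ballx t (e / (M + 1)) (divr_gt0 e0 M1).
  apply: filterS => y; rewrite -ball_normE /ball_/= ltr_pdivlMr// => /ltW H.
  have h0 (u : R) : 0 <= Num.max u 0 by rewrite le_max lexx orbT.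
  apply: le_trans (Xlip' _ _ (h0 y) (h0 t)) _.
  have : `|Num.max t 0 - Num.max y 0| <= `|t - y|.
    rewrite ler_norml; have := ler_norm (t - y); have := ler_norm (y - t).
    rewrite [`|y - t|]distrC.
    by case: (leP t 0) => ?; case: (leP y 0) => ?; move=> ? ?; apply/andP; split; lra.
  nra.
have [G [G0 dG]] : exists G : R -> 'cV[R]_N, G 0 = 0 /\
    forall t : R, -1 < t -> is_derive t 1 G (f (X (Num.max t 0))).
  apply: cv_antiderivative.
  have -> : (fun t : R => f (X (Num.max t 0))) = fun t : R => f ((X \o (fun s : R => Num.max s 0)) (Num.max t 0)).
    by apply/funext => t /=; congr (f (X _)); rewrite [RHS]max_l// le_max lexx orbT.
  by apply: (continuous_lip_half fL) => t _; exact: XgM.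
pose Y t := x0 + G t.
have XY : sol X Y.
  split; first by rewrite /Y G0 addr0.
  move=> t t0; rewrite -[f _]add0r.
  have t1 : -1 < t by apply: lt_le_trans t0; lra.
  have := dG t t1; rewrite max_l// => dGt.
  exact: (@is_deriveD _ _ _ _ _ _ _ _ _ (is_derive_cst x0 t 1) dGt).
have eqXY t : 0 <= t -> X t = Y t.
  move=> t0; apply/eqP; rewrite -subr_eq0 -normr_le0.
  apply: (@le_geometric_eps _ _ _ (2 * C * expR (2 * L * t))) => k; rewrite add0r.
  have H : forall u : R, 0 <= u -> `|Xs k u - X u| <= 2 * C * 2^-1 ^+ k * expR (2 * L * u).
    by move=> u u0; exact: XP.
  have h1 := solD _ _ _ _ _ (XsP.2 k) XY H t t0.
  have h2 := XP t t0 k.+1.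
  have -> : X t - Y t = (Xs k.+1 t - Y t) - (Xs k.+1 t - X t).
    by apply/colP => i; rewrite !mxE; ring.
  apply: le_trans (ler_normB _ _) _.
  move: h2; rewrite exprSr; lra.
exists Y; split; first exact: XY.1.
by move=> t t0; rewrite -eqXY//; exact: XY.2.
Qed.

End Picard.

(** * Euclidean norm *)

Section Euclid.
Variable R : realType.

Definition dot (k : nat) (x y : 'cV[R]_k) : R := \sum_i x i ord0 * y i ord0.

Section Dot.
Variable k : nat.
Implicit Types x y z : 'cV[R]_k.

Lemma dotC x y : dot x y = dot y x.
Proof. by apply: eq_bigr => i _; rewrite mulrC. Qed.

Lemma dotDl x y z : dot (x + y) z = dot x z + dot y z.
Proof. by rewrite -big_split; apply: eq_bigr => i _; rewrite mxE mulrDl. Qed.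

Lemma dotDr x y z : dot z (x + y) = dot z x + dot z y.
Proof. by rewrite dotC dotDl !(dotC z). Qed.

Lemma dotZl a x y : dot (a *: x) y = a * dot x y.
Proof. by rewrite mulr_sumr; apply: eq_bigr => i _; rewrite mxE mulrA. Qed.

Lemma dotZr a x y : dot x (a *: y) = a * dot x y.
Proof. by rewrite dotC dotZl dotC. Qed.

Lemma dotNl x y : dot (- x) y = - dot x y.
Proof. by rewrite -scaleN1r dotZl mulN1r. Qed.

Lemma dotNr x y : dot x (- y) = - dot x y.
Proof. by rewrite dotC dotNl dotC. Qed.

Lemma dotBl x y z : dot (x - y) z = dot x z - dot y z.
Proof. by rewrite dotDl dotNl. Qed.

Lemma dotBr x y z : dot z (x - y) = dot z x - dot z y.
Proof. by rewrite dotDr dotNr. Qed.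

Lemma dot_ge0 x : 0 <= dot x x.
Proof. by apply: sumr_ge0 => i _; rewrite -expr2 sqr_ge0. Qed.

Lemma dot_eq0 x : dot x x = 0 -> x = 0.
Proof.
move/eqP; rewrite psumr_eq0 => [/allP H|i _]; last by rewrite -expr2 sqr_ge0.
apply/colP => i; rewrite mxE; apply/eqP.
by have := H i (mem_index_enum i); rewrite /= mulf_eq0 orbb.
Qed.

(** Expand 0 <= |(y.y) x - (x.y) y|^2. *)
Lemma cauchy_schwarz x y : dot x y ^+ 2 <= dot x x * dot y y.
Proof.
have [/dot_eq0 ->|y0] := eqVneq (dot y y) 0.
  have -> : dot x 0 = 0 by rewrite -(scale0r x) dotZr mul0r.
  by rewrite expr0n mulr_ge0 ?dot_ge0.
have yp : 0 < dot y y by rewrite lt_def y0 dot_ge0.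
have := dot_ge0 (dot y y *: x - dot x y *: y).
rewrite !(dotBl, dotBr, dotZl, dotZr) (dotC y x) => H.
have {}H : 0 <= dot y y * (dot x x * dot y y - dot x y ^+ 2).
  by apply: le_trans H _; rewrite le_eqVlt; apply/orP; left; apply/eqP; ring.
by rewrite pmulr_rge0// subr_ge0 in H.
Qed.

Lemma enorm_ge0 x : 0 <= enorm x. Proof. exact: sqrtr_ge0. Qed.

Lemma enorm_sqr x : enorm x ^+ 2 = dot x x.
Proof.
have -> : enorm x = Num.sqrt (dot x x) by congr Num.sqrt; apply: eq_bigr.
by rewrite sqr_sqrtr// dot_ge0.
Qed.

Lemma enorm_le x (a : R) : 0 <= a -> (enorm x <= a) = (dot x x <= a ^+ 2).
Proof. by move=> a0; rewrite -enorm_sqr ler_sqr ?nnegrE ?enorm_ge0. Qed.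

Lemma normr_dot_le x y : `|dot x y| <= enorm x * enorm y.
Proof.
have p : 0 <= enorm x * enorm y by rewrite mulr_ge0 ?enorm_ge0.
rewrite -(@ler_pXn2r _ 2%N) ?nnegrE// real_normK ?num_real//.
by rewrite exprMn !enorm_sqr cauchy_schwarz.
Qed.

Lemma dot_le x y : dot x y <= enorm x * enorm y.
Proof. exact: le_trans (ler_norm _) (normr_dot_le _ _). Qed.

Lemma enormD x y : enorm (x + y) <= enorm x + enorm y.
Proof.
rewrite enorm_le ?addr_ge0 ?enorm_ge0// sqrrD !enorm_sqr dotDl !dotDr (dotC y x).
have := dot_le x y; lra.
Qed.

Lemma enormN x : enorm (- x) = enorm x.
Proof. by congr Num.sqrt; apply: eq_bigr => i _; rewrite mxE sqrrN. Qed.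

Lemma enormB x y : enorm (x - y) <= enorm x + enorm y.
Proof. by rewrite -(enormN y) enormD. Qed.

Lemma enormZ (a : R) x : enorm (a *: x) = `|a| * enorm x.
Proof.
apply/eqP; rewrite -(@eqrXn2 _ 2%N) ?mulr_ge0 ?enorm_ge0//.
by rewrite exprMn !enorm_sqr dotZl dotZr mulrA -expr2 real_normK ?num_real.
Qed.

Lemma coord_le_enorm x i : `|x i ord0| <= enorm x.
Proof.
rewrite -(@ler_pXn2r _ 2%N) ?nnegrE ?enorm_ge0// real_normK ?num_real//.
rewrite enorm_sqr /dot (bigD1 i)//= -expr2 lerDl sumr_ge0// => j _.
by rewrite -expr2 sqr_ge0.
Qed.

Lemma enorm_le_coord x (a : R) : 0 <= a -> (forall i, `|x i ord0| <= a) ->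
  enorm x <= k%:R * a.
Proof.
move=> a0 H; rewrite enorm_le ?mulr_ge0//.
apply: (@le_trans _ _ (\sum_(i < k) a ^+ 2)).
  apply: ler_sum => i _; rewrite -expr2 -[X in X <= _]real_normK ?num_real//.
  by rewrite ler_pXn2r ?nnegrE.
rewrite sumr_const card_ord exprMn -[leLHS]mulr_natl ler_wpM2r ?sqr_ge0//.
case: (k) => [|j]; first by rewrite expr0n.
by rewrite expr2 ler_peMl// ler1n.
Qed.

End Dot.

Lemma dot_trmx (k l : nat) (A : 'M[R]_(k, l)) x y :
  dot x (A *m y) = dot (A^T *m x) y.
Proof.
rewrite /dot; under eq_bigr do rewrite mxE big_distrr.
rewrite exchange_big; apply: eq_bigr => j _ /=.
by rewrite mxE big_distrl; apply: eq_bigr => i _ /=; rewrite mxE mulrCA mulrA.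
Qed.

Lemma dot_col_mx (k l : nat) (x x' : 'cV[R]_k) (y y' : 'cV[R]_l) :
  dot (col_mx x y) (col_mx x' y') = dot x x' + dot y y'.
Proof.
rewrite /dot big_split_ord /=; congr (_ + _); apply: eq_bigr => i _.
  by rewrite !col_mxEu.
by rewrite !col_mxEd.
Qed.

Lemma opnorm_exists (k l : nat) (A : 'M[R]_(k, l)) :
  exists2 K : R, 0 <= K & forall x, enorm (A *m x) <= K * enorm x.
Proof.
exists (k%:R * (l%:R * `|A|)); first by rewrite !mulr_ge0.
move=> x; rewrite -mulrA; apply: enorm_le_coord.
  by rewrite !mulr_ge0 ?enorm_ge0.
move=> i; rewrite mxE; apply: le_trans (ler_norm_sum _ _ _) _.
apply: (@le_trans _ _ (\sum_(j < l) `|A| * enorm x)).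
  apply: ler_sum => j _; rewrite normrM ler_pM//; first exact: le_mx_norm.
  exact: coord_le_enorm.
by rewrite sumr_const card_ord -[leLHS]mulr_natl mulrA.
Qed.

End Euclid.

(** * Quadratic Lyapunov forms of Hurwitz matrices *)

Section Lyapunov.
Variable R : realType.

Lemma Re_sum (I : finType) (f : I -> complex R) :
  complex.Re (\sum_i f i) = \sum_i complex.Re (f i).
Proof. by apply: (big_morph (@complex.Re R)) => // -[a b] [c d]. Qed.

Lemma Im_sum (I : finType) (f : I -> complex R) :
  complex.Im (\sum_i f i) = \sum_i complex.Im (f i).
Proof. by apply: (big_morph (@complex.Im R)) => // -[a b] [c d]. Qed.

Lemma ReJM (a b : complex R) : complex.Re (a^* * b) =
  complex.Re a * complex.Re b + complex.Im a * complex.Im b.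
Proof. by case: a b => [a1 a2] [b1 b2] /=; rewrite mulNr opprK. Qed.

Lemma ReM (a b : complex R) : complex.Re (a * b) =
  complex.Re a * complex.Re b - complex.Im a * complex.Im b.
Proof. by case: a b => [a1 a2] [b1 b2]. Qed.

Lemma ImM (a b : complex R) : complex.Im (a * b) =
  complex.Re a * complex.Im b + complex.Im a * complex.Re b.
Proof. by case: a b => [a1 a2] [b1 b2] /=; rewrite mulrC. Qed.

(** The Schur form T = U F U^-1 over the complex numbers, split into real and
    imaginary parts so that the Lyapunov form can be built over the reals:
    U = Ur + i Ui is unitary and T = Tr + i Ti is lower triangular. *)
Lemma hurwitz_schur (N : nat) (F : 'M[R]_N.+1) : hurwitz F ->
  exists Ur Ui Tr Ti : 'M[R]_N.+1,
    [/\ Ur^T *m Ur + Ui^T *m Ui = 1%:M,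
        Ur *m F = Tr *m Ur - Ti *m Ui /\ Ui *m F = Tr *m Ui + Ti *m Ur,
        forall i, Tr i i < 0 &
        forall i j : 'I_N.+1, (i < j)%N -> Tr i j = 0 /\ Ti i j = 0].
Proof.
move=> hF; set A := map_mx (real_complex R) F.
have [U Uu Ut] := @Schur _ _ A (ltn0Sn N).
set T := conjmx U A in Ut.
have Uunit := unitarymx_unit Uu.
have UA : U *m A = T *m U by rewrite /T conjumx// mulmxKV.
have UU : map_mx Num.conj U^T *m U = 1%:M.
  by rewrite -invmx_unitary// mulVmx.
pose re (M : 'M[complex R]_N.+1) := map_mx (@complex.Re R) M.
pose im (M : 'M[complex R]_N.+1) := map_mx (@complex.Im R) M.
exists (re U), (im U), (re T), (im T); split.
- apply/matrixP => i j; have /(congr1 (fun M : 'M[complex R]_(N.+1) => complex.Re (M i j))) := UU.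
  rewrite mxE Re_sum => H.
  rewrite !mxE in H *; have -> : ((i == j)%:R : R) = complex.Re ((i == j)%:R : complex R).
    by case: (i == j).
  rewrite -H -big_split; apply: eq_bigr => k _ /=.
  by rewrite !mxE ReJM.
- split; apply/matrixP => i j.
    have /(congr1 (fun M : 'M[complex R]_(N.+1) => complex.Re (M i j))) := UA.
    rewrite !mxE !Re_sum -sumrB => H.
    transitivity (\sum_k complex.Re (U i k * A k j)).
      by apply: eq_bigr => k _; rewrite !mxE ReM/= mulr0 subr0.
    by rewrite H; apply: eq_bigr => k _; rewrite !mxE ReM.
  have /(congr1 (fun M : 'M[complex R]_(N.+1) => complex.Im (M i j))) := UA.
  rewrite !mxE !Im_sum -big_split => H.
  transitivity (\sum_k complex.Im (U i k * A k j)).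
    by apply: eq_bigr => k _; rewrite !mxE ImM/= mulr0 add0r.
  by rewrite H; apply: eq_bigr => k _; rewrite !mxE ImM.
- move=> i; rewrite mxE; apply: hF.
  apply: (@eigenvalue_conjmx _ _ _ U A).
  + by rewrite stablemx_unit.
  + by rewrite row_free_unit.
  + rewrite -topredE/= eigenvalue_root_char char_poly_trig//.
    by rewrite (bigD1 i)//= rootM root_XsubC eqxx.
- move=> i j ij; have /is_trig_mxP := Ut => /(_ i j ij) Tij.
  by split; rewrite mxE Tij.
Qed.

End Lyapunov.

Section LyapunovForm.
Variable R : realType.

(** Weighted arithmetic-geometric inequality: a product of two coordinates whose
    weights differ by a factor eps is eps-small against the weighted squares. *)
Lemma cross_term_le (A B x y eps : R) :
  0 <= A -> 0 <= B -> 0 <= eps -> A <= eps * B ->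
  `|A ^+ 2 * (x * y)| <= eps * (A ^+ 2 * x ^+ 2 + B ^+ 2 * y ^+ 2) / 2.
Proof.
move=> A0 B0 e0 AB.
have -> : `|A ^+ 2 * (x * y)| = A * (A * (`|x| * `|y|)).
  by rewrite normrM [`|x * y|]normrM ger0_norm ?sqr_ge0// expr2 -mulrA.
have h : A * (A * (`|x| * `|y|)) <= eps * ((A * `|x|) * (B * `|y|)).
  have p : 0 <= A * (`|x| * `|y|) by rewrite !mulr_ge0.
  have -> : eps * ((A * `|x|) * (B * `|y|)) = (eps * B) * (A * (`|x| * `|y|)) by ring.
  exact: ler_wpM2r.
apply: le_trans h _; rewrite -[x ^+ 2]real_normK ?num_real// -[y ^+ 2]real_normK ?num_real//.
have := sqr_ge0 (A * `|x| - B * `|y|) => H.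
have -> : eps * (A ^+ 2 * `|x| ^+ 2 + B ^+ 2 * `|y| ^+ 2) / 2 =
  eps * ((A * `|x|) * (B * `|y|)) + eps * (A * `|x| - B * `|y|) ^+ 2 / 2 by field.
by rewrite lerDl divr_ge0// mulr_ge0.
Qed.

(** In the Schur coordinates p + i q = U x, the form
    S x = sum_k w_k^2 (p_k^2 + q_k^2) with w_k = eps^k has a derivative along F
    whose diagonal part is at most - al S x, the eigenvalues having real part at
    most - al.  Each entry of T below the diagonal couples a coordinate with one of
    larger weight, and contributes a term of order eps. *)
Lemma lyapunov (N : nat) (F : 'M[R]_N) : hurwitz F ->
  exists (P : 'M[R]_N) (a : R),
    [/\ 0 < a, P^T = P, forall x, a * dot x x <= dot x (P *m x) &
        forall x, dot x (P *m (F *m x)) <= - a * dot x x].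
Proof.
case: N F => [|N] F hF.
  by exists 0, 1; split=> [||x|x]; rewrite ?ltr01 ?trmx0 /dot ?big_ord0 ?mulr0.
have [Ur [Ui [Tr [Ti [UU [UF1 UF2] Tneg Ttrig]]]]] := hurwitz_schur hF.
have [al al0 Tal] : exists2 al : R, 0 < al & forall i, Tr i i <= - al.
  have [i _ H] := @Order.TotalTheory.arg_maxP _ _ _ (ord0 : 'I_N.+1) predT (fun i => Tr i i) isT.
  exists (- Tr i i); first by rewrite oppr_gt0.
  by move=> j; rewrite opprK; exact: H.
pose tau := `|Tr| + `|Ti|.
have tau0 : 0 <= tau by rewrite addr_ge0.
pose n : R := N.+1%:R.
have n1 : 1 <= n by rewrite ler1n.
(* the ratio of the weights is so small that the n^2 terms below the diagonal,
   each bounded by eps tau times the weighted squares, cost at most al / 2 *)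
pose eps := al / (4 * n * tau + al).
have den0 : 0 < 4 * n * tau + al by rewrite ltr_wpDl// !mulr_ge0//; lra.
have eps0 : 0 < eps by rewrite divr_gt0.
have eps1 : eps <= 1 by rewrite ler_pdivrMr// mul1r lerDr !mulr_ge0//; lra.
have epsal : 2 * n * tau * eps <= al / 2.
  rewrite mulrA ler_pdivrMr// .
  have : 0 <= n * tau by rewrite mulr_ge0//; lra.
  nra.
pose w (k : nat) := eps ^+ k.
have w0 k : 0 < w k by exact: exprn_gt0.
have wmin (k : 'I_N.+1) : (eps ^+ N) ^+ 2 <= w k ^+ 2.
  rewrite ler_sqr ?nnegrE ?exprn_ge0 ?(ltW eps0)//.
  by rewrite ler_wiXn2l// ?(ltW eps0)// -ltnS.
have wle (j k : nat) : (j < k)%N -> w k <= eps * w j.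
  move=> jk; rewrite -exprS ler_wiXn2l// ltW//.
pose W : 'M[R]_N.+1 := diag_mx (\row_k (w k ^+ 2)).
have WE (x y : 'cV[R]_N.+1) : dot x (W *m y) = \sum_(k < N.+1) w k ^+ 2 * (x k ord0 * y k ord0).
  by apply: eq_bigr => k _; rewrite mul_diag_mx !mxE mulrCA.
pose P := Ur^T *m W *m Ur + Ui^T *m W *m Ui.
have PE x y : dot x (P *m y) =
    dot (Ur *m x) (W *m (Ur *m y)) + dot (Ui *m x) (W *m (Ui *m y)).
  by rewrite mulmxDl dotDr -!mulmxA !(dot_trmx _^T) !trmxK.
have nU x : dot x x = dot (Ur *m x) (Ur *m x) + dot (Ui *m x) (Ui *m x).
  rewrite -{2}[x]mul1mx -UU mulmxDl dotDr -!mulmxA.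
  by rewrite !(dot_trmx _^T) !trmxK.
pose S (x : 'cV[R]_N.+1) := \sum_(k < N.+1) w k ^+ 2 * ((Ur *m x) k ord0 ^+ 2 + (Ui *m x) k ord0 ^+ 2).
have PS x : dot x (P *m x) = S x.
  rewrite PE !WE -big_split; apply: eq_bigr => k _ /=.
  by rewrite -mulrDr !expr2.
pose wm := (eps ^+ N) ^+ 2.
have wm0 : 0 < wm by rewrite !exprn_gt0.
have Smin x : wm * dot x x <= S x.
  rewrite nU /dot -big_split mulr_sumr; apply: ler_sum => k _ /=.
  by rewrite -!expr2 ler_wpM2r ?wmin// addr_ge0 ?sqr_ge0.
have Sneg x : dot x (P *m (F *m x)) <= - (al / 2) * S x.
  have -> : dot x (P *m (F *m x)) = \sum_(k < N.+1) \sum_j w k ^+ 2 *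
      (Tr k j * ((Ur *m x) k ord0 * (Ur *m x) j ord0 + (Ui *m x) k ord0 * (Ui *m x) j ord0)
       + Ti k j * ((Ui *m x) k ord0 * (Ur *m x) j ord0 - (Ur *m x) k ord0 * (Ui *m x) j ord0)).
    have E1 : Ur *m (F *m x) = Tr *m (Ur *m x) - Ti *m (Ui *m x).
      by rewrite mulmxA UF1 mulmxBl -!mulmxA.
    have E2 : Ui *m (F *m x) = Tr *m (Ui *m x) + Ti *m (Ur *m x).
      by rewrite mulmxA UF2 mulmxDl -!mulmxA.
    rewrite PE E1 E2 !WE -big_split.
    apply: eq_bigr => k _ /=.
    move: (Ur *m x) (Ui *m x) => p q.
    rewrite -mulr_sumr -mulrDr; congr (_ * _).
    rewrite !mxE mulrBr mulrDr !mulr_sumr -sumrB -!big_split.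
    by apply: eq_bigr => j _ /=; ring.
  rewrite /S; move: (Ur *m x) (Ui *m x) => p q.
  pose r (k : 'I_N.+1) := w k ^+ 2 * (p k ord0 ^+ 2 + q k ord0 ^+ 2).
  rewrite -/(\sum_k r k).
  have r0 k : 0 <= r k by rewrite mulr_ge0 ?sqr_ge0// addr_ge0 ?sqr_ge0.
  have G (k j : 'I_N.+1) : w k ^+ 2 *
      (Tr k j * (p k ord0 * p j ord0 + q k ord0 * q j ord0)
       + Ti k j * (q k ord0 * p j ord0 - p k ord0 * q j ord0)) <=
      (if j == k then - al * r k else 0) + eps * tau * (r k + r j).
    have et0 : 0 <= eps * tau by rewrite mulr_ge0// ltW.
    have err0 : 0 <= eps * tau * (r k + r j) by rewrite mulr_ge0// addr_ge0.
    have [->|jk] := eqVneq j k.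
      apply: (@le_trans _ _ (- al * r k)); last by rewrite lerDl mulr_ge0 ?addr_ge0.
      have -> : w k ^+ 2 * (Tr k k * (p k ord0 * p k ord0 + q k ord0 * q k ord0)
         + Ti k k * (q k ord0 * p k ord0 - p k ord0 * q k ord0)) = Tr k k * r k.
        by rewrite /r; ring.
      by rewrite ler_wpM2r.
    rewrite add0r; have [kj|jk'] := ltnP k j.
      by have [-> ->] := Ttrig k j kj; rewrite !mul0r addr0 mulr0.
    have {jk'}jk : (j < k)%N by rewrite ltn_neqAle jk jk'.
    have ab x y := @cross_term_le (w k) (w j) x y eps (ltW (w0 k)) (ltW (w0 j))
      (ltW eps0) (wle _ _ jk).
    have Trt : `|Tr k j| <= `|Tr| by exact: le_mx_norm.
    have Tit : `|Ti k j| <= `|Ti| by exact: le_mx_norm.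
    have er0 : 0 <= eps * (r k + r j) by rewrite mulr_ge0 ?addr_ge0// ltW.
    have h1 : `|w k ^+ 2 * (p k ord0 * p j ord0 + q k ord0 * q j ord0)| <=
        eps * (r k + r j).
      rewrite mulrDr; apply: le_trans (ler_normD _ _) _.
      apply: le_trans (lerD (ab _ _) (ab _ _)) _.
      apply: (@le_trans _ _ (eps * (r k + r j) / 2)); last by lra.
      by rewrite /r le_eqVlt; apply/orP; left; apply/eqP; field.
    have h2 : `|w k ^+ 2 * (q k ord0 * p j ord0 - p k ord0 * q j ord0)| <=
        eps * (r k + r j).
      rewrite mulrBr; apply: le_trans (ler_normB _ _) _.
      apply: le_trans (lerD (ab _ _) (ab _ _)) _.
      apply: (@le_trans _ _ (eps * (r k + r j) / 2)); last by lra.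
      by rewrite /r le_eqVlt; apply/orP; left; apply/eqP; field.
    rewrite mulrDr !(mulrCA (w k ^+ 2)).
    apply: (@le_trans _ _ (`|Tr| * (eps * (r k + r j)) + `|Ti| * (eps * (r k + r j)))).
      apply: lerD; apply: le_trans (ler_norm _) _; rewrite normrM ler_pM//.
    by rewrite -mulrDl -/tau mulrCA mulrA.
  apply: (@le_trans _ _ (\sum_k \sum_j ((if j == k then - al * r k else 0) +
      eps * tau * (r k + r j)))).
    by apply: ler_sum => k _; apply: ler_sum => j _; exact: G.
  have -> : \sum_k \sum_j ((if j == k then - al * r k else 0) +
      eps * tau * (r k + r j)) = (- al + 2 * n * tau * eps) * \sum_k r k.
    under eq_bigr do rewrite big_split/= -big_mkcond/= big_pred1_eq -mulr_sumr
      big_split/= sumr_const card_ord -[_ *+ _]mulr_natl -/n.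
    rewrite big_split/= -!mulr_sumr big_split/= -mulr_sumr sumr_const card_ord.
    by rewrite -[_ *+ _]mulr_natl -/n; ring.
  by apply: ler_wpM2r; [exact: sumr_ge0|lra].
exists P, (Num.min wm (al / 2 * wm)); split.
- by rewrite lt_min wm0 mulr_gt0// divr_gt0.
- by rewrite /P linearD/= !trmx_mul !trmxK tr_diag_mx !mulmxA.
- move=> x; rewrite PS; apply: le_trans (Smin x); rewrite ler_wpM2r ?dot_ge0//.
  by rewrite ge_min lexx.
- move=> x; apply: le_trans (Sneg x) _; rewrite mulNr [leRHS]mulNr lerN2.
  apply: (@le_trans _ _ (al / 2 * wm * dot x x)).
    by rewrite ler_wpM2r ?dot_ge0// ge_min lexx orbT.
  by rewrite -mulrA ler_wpM2l// divr_ge0// ltW.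
Qed.

End LyapunovForm.

(** * Stacked vectors and the diagonal action of matrices *)

Section Blocks.
Variable R : realType.

Lemma sum_tens (k m : nat) (f : 'I_(k * m) -> R) :
  \sum_r f r = \sum_(i < k) \sum_(j < m) f (mxtens_index (i, j)).
Proof.
rewrite pair_bigA (reindex (@mxtens_index k m)) /=; last first.
  by exists (@mxtens_unindex k m) => x _; rewrite ?mxtens_indexK ?mxtens_unindexK.
by apply: eq_bigr => -[i j].
Qed.

Lemma blkP (k m : nat) (x y : 'cV[R]_(k * m)) :
  (forall i, blk x i = blk y i) -> x = y.
Proof.
move=> H; apply/colP => r; case: (mxtens_indexP r) => i j.
by have /colP/(_ j) := H i; rewrite !mxE.
Qed.

Lemma blkD (k m : nat) (x y : 'cV[R]_(k * m)) i : blk (x + y) i = blk x i + blk y i.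
Proof. by apply/colP => j; rewrite !mxE. Qed.

Lemma blkN (k m : nat) (x : 'cV[R]_(k * m)) i : blk (- x) i = - blk x i.
Proof. by apply/colP => j; rewrite !mxE. Qed.

Lemma blkB (k m : nat) (x y : 'cV[R]_(k * m)) i : blk (x - y) i = blk x i - blk y i.
Proof. by rewrite blkD blkN. Qed.

Lemma dot_blk (k m : nat) (x y : 'cV[R]_(k * m)) :
  dot x y = \sum_i dot (blk x i) (blk y i).
Proof.
rewrite /dot sum_tens; apply: eq_bigr => i _; apply: eq_bigr => j _.
by rewrite !mxE.
Qed.

Lemma blk_tensmx (k l m : nat) (A : 'M[R]_(k, l)) (Q : 'M[R]_m) (x : 'cV[R]_(l * m)) i :
  blk (tensmx A Q *m x) i = \sum_j A i j *: (Q *m blk x j).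
Proof.
apply/colP => b; rewrite !mxE sum_tens summxE; apply: eq_bigr => j _.
rewrite !mxE mulr_sumr; apply: eq_bigr => c _.
by rewrite tensmxE !mxE mulrA.
Qed.

(** The matrix Q acting on each of the k blocks of a stacked vector. *)
Definition brot (k m : nat) (Q : 'M[R]_m) : 'M[R]_(k * m) := tensmx (1%:M : 'M[R]_k) Q.

Lemma blk_brot (k m : nat) (Q : 'M[R]_m) (x : 'cV[R]_(k * m)) i :
  blk (brot k Q *m x) i = Q *m blk x i.
Proof.
rewrite blk_tensmx (bigD1 i)//= big1 ?addr0 => [|j ji].
  by rewrite mxE eqxx scale1r.
by rewrite mxE eq_sym (negbTE ji) scale0r.
Qed.

Lemma brotM (k m : nat) (P Q : 'M[R]_m) : brot k P *m brot k Q = brot k (P *m Q).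
Proof. by rewrite tensmx_mul mulmx1. Qed.

Lemma brot1 (k m : nat) : brot k (1%:M : 'M[R]_m) = 1%:M.
Proof.
apply/matrixP => r c; case: (mxtens_indexP r) => i b; case: (mxtens_indexP c) => j d.
rewrite tensmxE !mxE -natrM mulnb (can_eq (@mxtens_indexK _ _)).
by rewrite xpair_eqE.
Qed.

Lemma ovl_brot (k l m : nat) (A : 'M[R]_(k, l)) (Q : 'M[R]_m) :
  ovl m A *m brot l Q = brot k Q *m ovl m A.
Proof. by rewrite !tensmx_mul mul1mx mulmx1 mul1mx mulmx1. Qed.

Lemma ovl_tr (k l m : nat) (A : 'M[R]_(k, l)) : (ovl m A)^T = ovl m A^T.
Proof. by rewrite trmx_tens trmx1. Qed.

Lemma blk_ovl (k l m : nat) (A : 'M[R]_(k, l)) (x : 'cV[R]_(l * m)) i :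
  blk (ovl m A *m x) i = \sum_j A i j *: blk x j.
Proof. by rewrite blk_tensmx; apply: eq_bigr => j _; rewrite mul1mx. Qed.

Lemma Dmx_trmul (k m : nat) (x y : 'cV[R]_(k * m)) i :
  ((Dmx x)^T *m y) i ord0 = dot (blk x i) (blk y i).
Proof.
rewrite mxE sum_tens (bigD1 i)//= [X in _ + X]big1 ?addr0 => [|j ji].
  by apply: eq_bigr => b _; rewrite !mxE !mxtens_indexK/= eqxx.
by apply: big1 => b _; rewrite !mxE !mxtens_indexK/= (negbTE ji) mul0r.
Qed.

Lemma blk_Dmx (k m : nat) (x : 'cV[R]_(k * m)) (u : 'cV[R]_k) i :
  blk (Dmx x *m u) i = u i ord0 *: blk x i.
Proof.
apply/colP => b; rewrite !mxE (bigD1 i)//= big1 ?addr0 => [|j ji].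
  by rewrite !mxE !mxtens_indexK/= eqxx mulrC.
by rewrite !mxE !mxtens_indexK/= eq_sym (negbTE ji) mul0r.
Qed.

Lemma Dmx_brot (k m : nat) (Q : 'M[R]_m) (x : 'cV[R]_(k * m)) :
  Dmx (brot k Q *m x) = brot k Q *m Dmx x.
Proof.
apply/matrixP => r c; case: (mxtens_indexP r) => i b.
have e (A : 'M[R]_(k * m, k)) : A (mxtens_index (i, b)) c =
    blk (A *m (delta_mx c ord0 : 'cV[R]_k)) i b ord0 by rewrite -colE !mxE.
by rewrite !e -mulmxA blk_brot !blk_Dmx blk_brot -scalemxAr.
Qed.

Lemma DmxD (k m : nat) (x y : 'cV[R]_(k * m)) : Dmx (x + y) = Dmx x + Dmx y.
Proof.
by apply/matrixP => r c; rewrite !mxE; case: ifP => _; rewrite ?addr0// !mxE.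
Qed.

Lemma DmxN (k m : nat) (x : 'cV[R]_(k * m)) : Dmx (- x) = - Dmx x.
Proof.
by apply/matrixP => r c; rewrite !mxE; case: ifP => _; rewrite ?oppr0// !mxE.
Qed.

Lemma errE (k m : nat) (zs z : 'cV[R]_(k * m)) i :
  err zs z i ord0 = dot (blk z i) (blk z i) - dot (blk zs i) (blk zs i).
Proof. by rewrite mxE !enorm_sqr. Qed.

Lemma orth_trmxK (m : nat) (Q : 'M[R]_m) : Q *m Q^T = 1%:M -> Q^T *m Q = 1%:M.
Proof. exact: mulmx1C. Qed.

Lemma dot_orth (m : nat) (Q : 'M[R]_m) (x y : 'cV[R]_m) : Q^T *m Q = 1%:M ->
  dot (Q *m x) (Q *m y) = dot x y.
Proof. by move=> QQ; rewrite dot_trmx mulmxA QQ mul1mx. Qed.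

Lemma dot_brot (k m : nat) (Q : 'M[R]_m) (x y : 'cV[R]_(k * m)) : Q^T *m Q = 1%:M ->
  dot (brot k Q *m x) (brot k Q *m y) = dot x y.
Proof.
by move=> QQ; rewrite !dot_blk; apply: eq_bigr => i _; rewrite !blk_brot dot_orth.
Qed.

Lemma err_brot (k m : nat) (zs z : 'cV[R]_(k * m)) (Q : 'M[R]_m) : Q^T *m Q = 1%:M ->
  err zs (brot k Q *m z) = err zs z.
Proof.
by move=> QQ; apply/colP => i; rewrite !errE blk_brot dot_orth.
Qed.

Lemma enorm_dot (k : nat) (x y : 'cV[R]_k) : dot x x = dot y y -> enorm x = enorm y.
Proof.
move=> H; apply/eqP; rewrite -(@eqrXn2 _ 2%N) ?enorm_ge0//.
by rewrite !enorm_sqr H.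
Qed.

Lemma enorm_brot (k m : nat) (Q : 'M[R]_m) (x : 'cV[R]_(k * m)) : Q^T *m Q = 1%:M ->
  enorm (brot k Q *m x) = enorm x.
Proof. by move=> QQ; apply: enorm_dot; exact: dot_brot. Qed.

Lemma brotK (k m : nat) (Q : 'M[R]_m) (l : nat) (x : 'M[R]_(k * m, l)) : Q^T *m Q = 1%:M ->
  brot k Q^T *m (brot k Q *m x) = x.
Proof.
by move=> QQ; rewrite mulmxA brotM QQ brot1 mul1mx.
Qed.

Lemma Dmx_mul_le (k m : nat) (x : 'cV[R]_(k * m)) (u : 'cV[R]_k) :
  enorm (Dmx x *m u) <= enorm x * enorm u.
Proof.
rewrite enorm_le ?mulr_ge0 ?enorm_ge0// dot_blk exprMn !enorm_sqr dot_blk mulr_suml.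
apply: ler_sum => i _; rewrite blk_Dmx dotZl dotZr mulrA -expr2 mulrC.
rewrite ler_wpM2l ?dot_ge0// -enorm_sqr -real_normK ?num_real//.
by rewrite ler_sqr ?nnegrE ?enorm_ge0// coord_le_enorm.
Qed.

Lemma Dmx_trmul_le (k m : nat) (x y : 'cV[R]_(k * m)) :
  enorm ((Dmx x)^T *m y) <= enorm x * enorm y.
Proof.
rewrite enorm_le ?mulr_ge0 ?enorm_ge0// exprMn !enorm_sqr (dot_blk x) mulr_suml.
apply: ler_sum => i _; rewrite Dmx_trmul -expr2.
apply: le_trans (cauchy_schwarz _ _) _; rewrite ler_wpM2l ?dot_ge0//.
by rewrite dot_blk (bigD1 i)//= lerDl sumr_ge0// => j _; rewrite dot_ge0.
Qed.

End Blocks.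

(** * The kernel of the rigidity matrix *)

Section Kernel.
Variables (R : realType) (n nE m : nat) (G : graph n nE).

Lemma edge_neq k : etail G k != ehead G k.
Proof. by case: G => e H1 H2; exact: H1. Qed.

Lemma incidence_sum (V : lmodType R) (f : 'I_n -> V) k :
  \sum_i incidence R G i k *: f i = f (etail G k) - f (ehead G k).
Proof.
have th := edge_neq k.
rewrite (bigD1 (etail G k))//= (bigD1 (ehead G k))/=; last by rewrite eq_sym.
rewrite big1 ?addr0 => [|i /andP[it ih]].
  by rewrite !mxE !eqxx eq_sym (negbTE th) scale1r scaleN1r.
by rewrite mxE (negbTE it) (negbTE ih) scale0r.
Qed.

Lemma blk_relpos (p : 'cV[R]_(n * m)) k :
  blk (relpos G p) k = blk p (etail G k) - blk p (ehead G k).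
Proof.
rewrite /relpos ovl_tr blk_ovl -incidence_sum.
by apply: eq_bigr => i _; rewrite mxE.
Qed.

Lemma relpos_brot (Q : 'M[R]_m) (p : 'cV[R]_(n * m)) :
  relpos G (brot n Q *m p) = brot nE Q *m relpos G p.
Proof. by rewrite /relpos ovl_tr mulmxA ovl_brot mulmxA. Qed.

Lemma relposD (p q : 'cV[R]_(n * m)) : relpos G (p + q) = relpos G p + relpos G q.
Proof. exact: mulmxDr. Qed.

Lemma relposB (p q : 'cV[R]_(n * m)) : relpos G (p - q) = relpos G p - relpos G q.
Proof. exact: mulmxBr. Qed.

Definition skew_symmetric (A : 'M[R]_m) := A^T = - A.

Lemma skew_dot (A : 'M[R]_m) (x : 'cV[R]_m) : skew_symmetric A -> dot x (A *m x) = 0.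
Proof.
move=> sA; apply/eqP; rewrite -[_ == 0](mulrn_eq0 _ 2) mulr2n.
by rewrite {1}dot_trmx sA mulNmx dotNl dotC addNr.
Qed.

Lemma rigidityE (z : 'cV[R]_(nE * m)) (p : 'cV[R]_(n * m)) :
  rigidity G z *m p = (Dmx z)^T *m relpos G p.
Proof. by rewrite /rigidity /relpos mulmxA. Qed.

(** The translations of R^m and the motions p |-> A p, for A in the span of r
    skew-symmetric matrices, lie in the kernel of the rigidity matrix.  When they
    are independent, which is what the last hypothesis on Om gives, their number
    m + r is the dimension of that kernel, so they exhaust it. *)
Lemma kernel_of_basis (r : nat) (Om : 'I_r -> 'M[R]_m) (ps : 'cV[R]_(n * m)) :
  (0 < n)%N -> (nE + (m + r) = n * m)%N ->
  \rank (rigidity G (relpos G ps)) = nE ->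
  (forall l, skew_symmetric (Om l)) ->
  (forall w : 'cV[R]_r, (forall k, (\sum_l w l ord0 *: Om l) *m blk (relpos G ps) k = 0) ->
    w = 0) ->
  forall p : 'cV[R]_(n * m), rigidity G (relpos G ps) *m p = 0 ->
  exists2 A, skew_symmetric A & relpos G p = brot nE A *m relpos G ps.
Proof.
move=> n0 dimE rk sOm inj p Rp.
set zs := relpos G ps in rk inj Rp *.
pose Omw (w : 'cV[R]_r) := \sum_l w l ord0 *: Om l.
have sOmw w : skew_symmetric (Omw w).
  rewrite /skew_symmetric /Omw linear_sum/= -sumrN; apply: eq_bigr => l _.
  by rewrite linearZ/= sOm scalerN.
pose Et : 'M[R]_(n * m, m) := \matrix_(c, a) ((mxtens_unindex c).2 == a)%:R.
pose Rt : 'M[R]_(n * m, r) := \matrix_(c, l) (brot n (Om l) *m ps) c ord0.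
pose Mt := row_mx Et Rt.
have blkEt (a : 'cV[R]_m) i : blk (Et *m a) i = a.
  apply/colP => b; rewrite !mxE (bigD1 b)//= big1 ?addr0 => [|c cb].
    by rewrite mxE mxtens_indexK/= eqxx mul1r.
  by rewrite mxE mxtens_indexK/= eq_sym (negbTE cb) mul0r.
have RtE (w : 'cV[R]_r) : Rt *m w = brot n (Omw w) *m ps.
  apply: blkP => i; rewrite blk_brot; apply/colP => b.
  rewrite mxE [LHS]mxE /Omw mulmx_suml summxE; apply: eq_bigr => l _.
  rewrite [Rt _ _]mxE -scalemxAl [RHS]mxE mulrC; congr (_ * _).
  by rewrite -blk_brot [RHS]mxE.
have MtE (v : 'cV[R]_(m + r)) : Mt *m v = Et *m usubmx v + brot n (Omw (dsubmx v)) *m ps.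
  by rewrite -{1}[v]vsubmxK mul_row_col RtE.
have relMt (v : 'cV[R]_(m + r)) : relpos G (Mt *m v) = brot nE (Omw (dsubmx v)) *m zs.
  rewrite MtE relposD relpos_brot -[RHS]add0r; congr (_ + _).
  by apply: blkP => k; rewrite blk_relpos !blkEt subrr; apply/colP => b; rewrite !mxE.
have RM (v : 'cV[R]_(m + r)) : rigidity G zs *m (Mt *m v) = 0.
  rewrite rigidityE relMt; apply/colP => k; rewrite Dmx_trmul blk_brot skew_dot//.
  by rewrite mxE.
have sub : (Mt^T <= kermx (rigidity G zs)^T)%MS.
  apply/sub_kermxP; rewrite -trmx_mul; apply/trmx_inj; rewrite trmxK trmx0.
  apply/matrixP => i j.
  have := RM (delta_mx j ord0); rewrite mulmxA -colE => /colP/(_ i).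
  by rewrite !mxE.
have rM : row_free Mt^T.
  apply: inj_row_free => v vM; set u := v^T.
  have Mu : Mt *m u = 0 by apply/trmx_inj; rewrite trmx_mul trmxK vM trmx0.
  have w0 : dsubmx u = 0.
    apply: inj => k; have := relMt u; rewrite Mu /relpos mulmx0.
    move=> /(congr1 (fun x => blk x k)); rewrite blk_brot => <-.
    by apply/colP => b; rewrite !mxE.
  have a0 : usubmx u = 0.
    rewrite -(blkEt (usubmx u) (Ordinal n0)); have := MtE u.
    rewrite Mu w0 /Omw; under eq_bigr do rewrite mxE scale0r.
    rewrite big1// => /(congr1 (fun x => blk x (Ordinal n0))).
    rewrite blkD blk_brot mul0mx addr0 => <-.
    by apply/colP => b; rewrite !mxE.
  by apply/trmx_inj; rewrite -/u -[u]vsubmxK w0 a0 col_mx0 trmx0.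
have sup : (kermx (rigidity G zs)^T <= Mt^T)%MS.
  rewrite -(mxrank_leqif_sup sub).2 mxrank_ker (eqP rM) mxrank_tr rk.
  by rewrite -dimE addKn.
have : (p^T <= Mt^T)%MS.
  apply: submx_trans sup; apply/sub_kermxP.
  by rewrite -trmx_mul Rp trmx0.
move/submxP => [D pD].
have -> : p = Mt *m D^T by apply/trmx_inj; rewrite pD trmx_mul trmxK.
by exists (Omw (dsubmx D^T)) => //; exact: relMt.
Qed.

End Kernel.

Section RotationGenerators.
Variable R : realType.

Lemma skewmxP (m : nat) (A : 'M[R]_m) : (forall i j, A j i = - A i j) -> skew_symmetric A.
Proof. by move=> H; apply/matrixP => i j; rewrite !mxE H. Qed.

Definition table_mx (m : nat) (s : seq (seq R)) : 'M[R]_m :=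
  \matrix_(i, j) nth 0 (nth [::] s i) j.

(** The rotation by a right angle. *)
Definition plane_gen (l : 'I_1) : 'M[R]_2 :=
  table_mx 2 [:: [:: 0; -1]; [:: 1; 0]].

(** The cross products with the three vectors of the canonical basis. *)
Definition space_gen (l : 'I_3) : 'M[R]_3 :=
  table_mx 3 (nth [::]
    [:: [:: [:: 0; 0; 0]; [:: 0; 0; -1]; [:: 0; 1; 0]];
        [:: [:: 0; 0; 1]; [:: 0; 0; 0]; [:: -1; 0; 0]];
        [:: [:: 0; -1; 0]; [:: 1; 0; 0]; [:: 0; 0; 0]]] l).

Lemma skewmx_plane l : skew_symmetric (plane_gen l).
Proof.
apply: skewmxP => -[[|[|//]] Hi] [[|[|//]] Hj]; by rewrite !mxE /= ?oppr0 ?opprK.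
Qed.

Lemma skewmx_space l : skew_symmetric (space_gen l).
Proof.
apply: skewmxP => i j; rewrite !mxE.
case: l i j => [[|[|[|//]]] Hl] [[|[|[|//]]] Hi] [[|[|[|//]]] Hj];
  by rewrite /= ?oppr0 ?opprK.
Qed.

Let o0 : 'I_3 := ord0.
Let o1 : 'I_3 := lift ord0 ord0.
Let o2 : 'I_3 := lift ord0 (lift ord0 ord0).

Lemma plane_gen_ker (w : 'cV[R]_1) (x : 'cV[R]_2) :
  (\sum_l w l ord0 *: plane_gen l) *m x = 0 -> w = 0 \/ x = 0.
Proof.
rewrite big_ord_recl big_ord0 addr0 -scalemxAl => /eqP.
rewrite scaler_eq0 => /orP[/eqP w0|/eqP/colP H].
  by left; apply/colP => i; rewrite (ord1 i) w0 mxE.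
right; have := H ord0; have := H (lift ord0 ord0).
rewrite !mxE !big_ord_recl !big_ord0 !mxE/= => h1 h2.
apply/colP => -[[|[|//]] Hi]; rewrite mxE.
  by rewrite (_ : Ordinal Hi = ord0); [lra|apply/val_inj].
by rewrite (_ : Ordinal Hi = lift ord0 ord0); [lra|apply/val_inj].
Qed.

(** A vanishing cross product. *)
Lemma space_gen_ker_collinear (w x : 'cV[R]_3) :
  (\sum_l w l ord0 *: space_gen l) *m x = 0 ->
  forall i j, w i ord0 * x j ord0 = w j ord0 * x i ord0.
Proof.
move=> /colP H.
have := H o0; have := H o1; have := H o2.
rewrite !mxE !big_ord_recl !big_ord0 !mxE/=.
move=> h2 h1 h0.
have oE (i : 'I_3) : [\/ i = o0, i = o1 | i = o2].
  case: i => [[|[|[|//]]] Hi]; [apply: Or31|apply: Or32|apply: Or33]; exact/val_inj.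
by move=> i j; case: (oE i) => ->; case: (oE j) => ->; lra.
Qed.

End RotationGenerators.

Section RigidKernel.
Variable R : realType.

(** Each column sums to 0. *)
Lemma rank_incidence_lt (n nE : nat) (G : graph n nE) : (0 < n)%N ->
  (\rank (incidence R G) < n)%N.
Proof.
move=> n0; rewrite ltn_neqAle rank_leq_row andbT; apply/negP => rf.
have /row_freeP[B IB] : row_free (incidence R G) by [].
have one0 : (const_mx 1 : 'rV[R]_n) *m incidence R G = 0.
  apply/rowP => k; rewrite mxE [RHS]mxE.
  transitivity (\sum_i incidence R G i k *: (1 : R^o)).
    by apply: eq_bigr => i _; rewrite [const_mx _ _ _]mxE mulrC.
  by rewrite (incidence_sum G (fun=> 1 : R^o)) subrr.
have : (const_mx 1 : 'rV[R]_n) = 0 by rewrite -[LHS]mulmx1 -IB mulmxA one0 mul0mx.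
move/rowP/(_ (Ordinal n0)); rewrite !mxE => /eqP; by rewrite oner_eq0.
Qed.

(** A framework on a line has a rigidity matrix that factors through the incidence
    matrix. *)
Lemma collinear_rank (n nE m : nat) (G : graph n nE) (z : 'cV[R]_(nE * m)) (w : 'cV[R]_m)
    (s : 'I_nE -> R) : (0 < n)%N ->
  (forall k, blk z k = s k *: w) -> (\rank (rigidity G z) < n)%N.
Proof.
move=> n0 zw.
pose W : 'M[R]_(n, n * m) := \matrix_(i, c)
  (if (mxtens_unindex c).1 == i then w (mxtens_unindex c).2 ord0 else 0).
have -> : rigidity G z = diag_mx (\row_k s k) *m ((incidence R G)^T *m W).
  apply/matrixP => k c; rewrite mul_diag_mx !mxE.
  case: (mxtens_indexP c) => i b.
  have -> : \sum_j (incidence R G)^T k j * W j (mxtens_index (i, b)) = incidence R G i k * w b ord0.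
    rewrite (bigD1 i)//= big1 ?addr0 => [|j ji]; rewrite !mxE mxtens_indexK/=.
      by rewrite eqxx.
    by rewrite [i == j]eq_sym (negbTE ji) mulr0.
  rewrite sum_tens (bigD1 k)//= [X in _ + X]big1 ?addr0 => [|j jk]; last first.
    by apply: big1 => a _; rewrite !mxE mxtens_indexK/= (negbTE jk) mul0r.
  rewrite (bigD1 b)//= [X in _ + X]big1 ?addr0 => [|a ab].
    rewrite [(Dmx z)^T _ _]mxE [Dmx z _ _]mxE mxtens_indexK/= eqxx.
    rewrite [(ovl _ _)^T _ _]mxE tensmxE [1%:M _ _]mxE eqxx mulr1.
    by rewrite zw mxE; ring.
  rewrite [(ovl _ _)^T _ _]mxE tensmxE [1%:M _ _]mxE eq_sym (negbTE ab).
  by rewrite !mulr0.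
apply: leq_ltn_trans (rank_incidence_lt G n0).
rewrite -(mxrank_tr (incidence R G)).
exact: leq_trans (mxrankM_maxr _ _) (mxrankM_maxl _ _).
Qed.

(** The generators of rotations are independent as motions of the framework, unless
    all relative positions vanish (m = 2) or are collinear (m = 3).  Either would
    make the rank of the rigidity matrix too small, except for m = 3 and n = 2,
    where the graph has no edge and the claim is void. *)
Theorem rigid_kernel (n nE m : nat) (G : graph n nE) (ps : 'cV[R]_(n * m)) :
  (2 <= n)%N -> inf_min_rigid G ps ->
  forall p : 'cV[R]_(n * m), rigidity G (relpos G ps) *m p = 0 ->
  exists2 A, skew_symmetric A & relpos G p = brot nE A *m relpos G ps.
Proof.
move=> n2 [[m2 [rk dimE]]|[m3 [rk dimE]]]; subst m.
- apply: (kernel_of_basis (Om := plane_gen R)) => //; try lia.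
    exact: skewmx_plane.
  move=> w H; apply/eqP; apply/negP => /negP w0.
  have zs0 : relpos G ps = 0.
    apply: blkP => k; have [w0'|->] := plane_gen_ker (H k); first by rewrite w0' eqxx in w0.
    by apply/colP => b; rewrite !mxE.
  have : rigidity G (relpos G ps) = 0.
    rewrite /rigidity zs0 (_ : Dmx 0 = 0) ?trmx0 ?mul0mx//.
    by apply/matrixP => r c; rewrite !mxE; case: ifP => // _; rewrite !mxE.
  move=> R0; move: rk; rewrite R0 mxrank0; lia.
- have [nE0|nEp] := posnP nE.
    move=> p _; exists 0; first by rewrite /skew_symmetric trmx0 oppr0.
    by apply: blkP => k; have := ltn_ord k; rewrite {2}nE0 ltn0.
  apply: (kernel_of_basis (Om := space_gen R)) => //; try lia.
    exact: skewmx_space.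
  move=> w H; apply/eqP; apply/negP => /negP w0.
  have [l wl] : exists l, w l ord0 != 0.
    apply/existsP; apply: contraR w0; rewrite negb_exists => /forallP w0.
    by apply/eqP/colP => l; rewrite mxE; apply/eqP; rewrite -[_ == _]negbK w0.
  have zw k : blk (relpos G ps) k = (blk (relpos G ps) k l ord0 / w l ord0) *: w.
    apply/colP => i; have := space_gen_ker_collinear (H k) l i.
    by move=> E; apply: (mulfI wl); rewrite E [in RHS]mxE; field.
  have n0 : (0 < n)%N by lia.
  have := collinear_rank G n0 zw; rewrite rk; lia.
Qed.

End RigidKernel.

(** * The closest rotated configuration *)

Section Procrustes.
Variable R : realType.

Lemma continuous_sum (T : topologicalType) (I : finType) (F : I -> T -> R) :
  (forall i, continuous (F i)) -> continuous (fun x => \sum_i F i x).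
Proof. by move=> cF; apply: continuous_big => //; exact: add_continuous. Qed.

Lemma continuous_prod (T : topologicalType) (I : finType) (F : I -> T -> R) :
  (forall i, continuous (F i)) -> continuous (fun x => \prod_i F i x).
Proof. by move=> cF; apply: continuous_big => //; exact: mul_continuous. Qed.

(** SO(m) is compact, being closed and bounded.  The matrices are flattened to row
    vectors in order to apply bounded_closed_compact. *)
Lemma closest_rotation (k m : nat) (z zs : 'cV[R]_(k * m)) :
  exists2 Q, special_orth Q & forall Q', special_orth Q' ->
    enorm (z - brot k Q *m zs) <= enorm (z - brot k Q' *m zs).
Proof.
pose A := [set u : 'rV[R]_(m * m) | special_orth (vec_mx u)].
have ce i j : continuous (fun u : 'rV[R]_(m * m) => vec_mx u i j).
  move=> u; have -> : (fun u : 'rV[R]_(m * m) => vec_mx u i j) =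
      (fun u => u ord0 (mxvec_index i j)) by apply/funext => v; rewrite mxE.
  exact: coord_continuous.
have cM (T : topologicalType) (f g : T -> R) :
  continuous f -> continuous g -> continuous (fun x => f x * g x).
  by move=> cf cg x; apply: cvgM; [exact: cf|exact: cg].
have cB (T : topologicalType) (f g : T -> R) :
  continuous f -> continuous g -> continuous (fun x => f x - g x).
  by move=> cf cg x; apply: cvgB; [exact: cf|exact: cg].
have cc (T : topologicalType) (a : R) : continuous (fun _ : T => a).
  by move=> x; exact: cvg_cst.
have cQQ i j : continuous (fun u : 'rV[R]_(m * m) => (vec_mx u *m (vec_mx u)^T) i j).
  have -> : (fun u : 'rV[R]_(m * m) => (vec_mx u *m (vec_mx u)^T) i j) =
    (fun u => \sum_l (vec_mx u i l * vec_mx u j l)).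
    by apply/funext => u; rewrite !mxE; apply: eq_bigr => l _; rewrite !mxE.
  by apply: continuous_sum => l; apply: cM; exact: ce.
have cdet : continuous (fun u : 'rV[R]_(m * m) => \det (vec_mx u : 'M[R]_m)).
  apply: continuous_sum => s; apply: cM; first exact: cc.
  by apply: continuous_prod => i; exact: ce.
have cA : compact A.
  apply: bounded_closed_compact.
    exists 1; split; first exact: num_real.
    move=> M M1 u [/matrixP QQ _]; apply/mx_norm_leP; first lra.
    move=> i0 c; case/mxvec_indexP: c => i j; rewrite (ord1 i0).
    apply: le_trans (ltW M1).
    have := QQ i i; rewrite !mxE eqxx (bigD1 j)//= !mxE => H.
    have : 0 <= \sum_(l < m | l != j) vec_mx u i l * (vec_mx u)^T l i.
      by apply: sumr_ge0 => l _; rewrite [_^T _ _]mxE -expr2 sqr_ge0.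
    move=> H2; rewrite -(@ler_pXn2r _ 2%N) ?nnegrE// expr1n real_normK ?num_real//.
    move: H; lra.
  have -> : A = (\bigcap_(ij in [set: 'I_m * 'I_m])
      [set u | (vec_mx u *m (vec_mx u)^T) ij.1 ij.2 = (1%:M : 'M[R]_m) ij.1 ij.2]) `&`
      [set u | \det (vec_mx u : 'M[R]_m) = 1].
    apply/seteqP; split => u [H1 H2]; split => //.
      by move=> ij _ /=; rewrite H1.
    by apply/matrixP => i j; exact: (H1 (i, j)).
  apply: closedI.
    apply: closed_bigI => ij _.
    apply: (@preimage_closed _ _ (fun u : 'rV[R]_(m * m) => (vec_mx u *m (vec_mx u)^T) ij.1 ij.2)
      [set x | x = (1%:M : 'M[R]_m) ij.1 ij.2]).
      by move=> x _; exact: cQQ.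
    exact: closed_eq.
  apply: (@preimage_closed _ _ (fun u : 'rV[R]_(m * m) => \det (vec_mx u : 'M[R]_m)) [set x | x = 1]).
    by move=> x _; exact: cdet.
  exact: closed_eq.
pose f (u : 'rV[R]_(m * m)) := dot (z - brot k (vec_mx u) *m zs) (z - brot k (vec_mx u) *m zs).
have cf : continuous f.
  pose g i j (u : 'rV[R]_(m * m)) := z (mxtens_index (i, j)) ord0 -
    \sum_l vec_mx u j l * zs (mxtens_index (i, l)) ord0.
  have gE i j u : (blk z i - vec_mx u *m blk zs i) j ord0 = g i j u.
    by rewrite !mxE; congr (_ - _); apply: eq_bigr => l _; rewrite !mxE.
  have -> : f = fun u => \sum_i \sum_j g i j u * g i j u.
    apply/funext => u; rewrite /f dot_blk; apply: eq_bigr => i _.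
    by apply: eq_bigr => j _; rewrite blkB blk_brot gE.
  apply: continuous_sum => i; apply: continuous_sum => j; apply: (cM _);
    apply: (cB _); try exact: cc; apply: continuous_sum => l; apply: (cM _);
    by [exact: ce|exact: cc].
have A0 : A !=set0.
  by exists (mxvec 1%:M); rewrite /A/= mxvecK; split; rewrite ?trmx1 ?mulmx1 ?det1.
have [u uA umin] := compact_EVT_min A0 cA (continuous_subspaceT cf).
exists (vec_mx u); first by move: uA; rewrite inE.
move=> Q' oQ'; rewrite enorm_le ?enorm_ge0// enorm_sqr.
have := umin (mxvec Q'); rewrite /f mxvecK; apply.
by rewrite inE /A/= mxvecK.
Qed.

(** With Om = E_ij - E_ji and Pi = E_ii + E_jj, the matrix H is the rotation of
    cosine c and sine s in the plane of the coordinates i and j.  Taking its square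
    makes the determinant equal to 1 without computing it. *)
Lemma givens_orth (m : nat) (Om Pi : 'M[R]_m) (c s : R) :
  Om^T = - Om -> Om *m Om = - Pi -> Om *m Pi = Om -> Pi *m Om = Om ->
  Pi *m Pi = Pi -> c ^+ 2 + s ^+ 2 = 1 ->
  let H := 1%:M + (c - 1) *: Pi + s *: Om in
  special_orth (H *m H) /\
  H *m H = 1%:M + (- 2 * s ^+ 2) *: Pi + (2 * c * s) *: Om.
Proof.
move=> OmT OO OP PO PP cs H.
have PT : Pi^T = Pi.
  by rewrite -[Pi]opprK -OO linearN/= trmx_mul OmT mulNmx mulmxN opprK.
have HT : H^T = 1%:M + (c - 1) *: Pi - s *: Om.
  by rewrite /H !linearD/= !linearZ/= trmx1 PT OmT scalerN.
have mul (a b a' b' : R) : (1%:M + a *: Pi + b *: Om) *m (1%:M + a' *: Pi + b' *: Om) =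
    1%:M + (a + a' + a * a' - b * b') *: Pi + (b + b' + a * b' + b * a') *: Om.
  rewrite !(mulmxDl, mulmxDr, mul1mx, mulmx1) -!(scalemxAl, scalemxAr).
  rewrite OO OP PO PP; apply/matrixP => i j; rewrite !mxE; ring.
have HH : H *m H^T = 1%:M.
  rewrite HT -scaleNr mul.
  have -> : c - 1 + (c - 1) + (c - 1) * (c - 1) - s * - s = 0.
    by transitivity (c ^+ 2 + s ^+ 2 - 1); [ring|rewrite cs subrr].
  have -> : s + - s + (c - 1) * - s + s * (c - 1) = 0 by ring.
  by rewrite !scale0r !addr0.
split; last first.
  rewrite mul; congr (_ + _ *: _ + _ *: _); [|ring].
  have -> : c - 1 + (c - 1) + (c - 1) * (c - 1) - s * s = c ^+ 2 - 1 - s ^+ 2 by ring.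
  by move: cs; lra.
split.
  by rewrite trmx_mul mulmxA -(mulmxA H) HH mulmx1 HH.
by rewrite det_mulmx -{2}det_tr -det_mulmx HH det1.
Qed.

(** First-order optimality at t = 0, where F is the slope and P bounds the second
    order. *)
Lemma slope_zero (F P : R) :
  (forall t : R, 0 < t -> (1 - t ^+ 2) * F <= 2 * t * P) -> F <= 0.
Proof.
move=> H; rewrite leNgt; apply/negP => F0.
have D0 : 0 < 4 * (`|P| + F) by rewrite mulr_gt0// ltr_wpDl.
pose t := F / (4 * (`|P| + F)).
have t0 : 0 < t by rewrite divr_gt0.
have t4 : t <= 1 / 4 by rewrite ler_pdivrMr//; have := normr_ge0 P; lra.
have tP : t * `|P| <= F / 4.
  rewrite /t mulrAC ler_pdivrMr//.
  have := normr_ge0 P; nra.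
have := H t t0; have : 2 * t * P <= 2 * (t * `|P|).
  by rewrite -mulrA ler_wpM2l// ler_wpM2l ?ler_norm// ltW.
have t2 : t ^+ 2 <= 1 / 16 by nra.
have : 15 / 16 * F <= (1 - t ^+ 2) * F by apply: (ler_wpM2r (ltW F0)); lra.
lra.
Qed.

(** If the identity is the rotation that brings zs closest to z, then z is
    orthogonal to all infinitesimal rotations of zs.  It suffices to test the
    rotations in coordinate planes, parametrized rationally by
    c = (1 - t^2) / (1 + t^2) and s = 2 t / (1 + t^2). *)
Lemma optimal_skew (k m : nat) (z zs : 'cV[R]_(k * m)) :
  (forall H : 'M[R]_m, special_orth H -> dot z (brot k H *m zs) <= dot z zs) ->
  forall A, skew_symmetric A -> dot z (brot k A *m zs) = 0.
Proof.
move=> opt.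
pose f (A : 'M[R]_m) := dot z (brot k A *m zs).
have fE A : f A = \sum_i dot (blk z i) (A *m blk zs i).
  by rewrite /f dot_blk; apply: eq_bigr => i _; rewrite blk_brot.
have fD A B : f (A + B) = f A + f B.
  by rewrite !fE -big_split; apply: eq_bigr => i _; rewrite mulmxDl dotDr.
have fZ a A : f (a *: A) = a * f A.
  by rewrite !fE mulr_sumr; apply: eq_bigr => i _; rewrite -scalemxAl dotZr.
have fB A B : f (A - B) = f A - f B.
  by rewrite fD -scaleN1r fZ mulN1r.
have f1 : f 1%:M = dot z zs by rewrite /f brot1 mul1mx.
have fS (I : finType) (B : I -> 'M[R]_m) : f (\sum_i B i) = \sum_i f (B i).
  apply: (big_morph f fD); rewrite -(scale0r (0 : 'M[R]_m)) fZ mul0r//.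
have half (i j : 'I_m) : i != j -> f (delta_mx i j - delta_mx j i) <= 0.
  move=> ij; set Om := delta_mx i j - delta_mx j i.
  pose Pi : 'M[R]_m := delta_mx i i + delta_mx j j.
  have ji : (j == i) = false by rewrite eq_sym (negbTE ij).
  have [OmT OO OP PO PP] : [/\ Om^T = - Om, Om *m Om = - Pi, Om *m Pi = Om, Pi *m Om = Om &
      Pi *m Pi = Pi].
    rewrite /Om /Pi [(_ - _)^T]linearB/= !trmx_delta opprB; split=> //;
    rewrite !(mulmxDl, mulmxDr, mulNmx, mulmxN) !mul_delta_mx_cond !eqxx ji (negbTE ij) !mulr0n !mulr1n;
    by apply/matrixP => a b; rewrite !mxE; ring.
  apply: (@slope_zero _ (f Pi)) => t t0.
  have d0 : 0 < 1 + t ^+ 2 by rewrite ltr_wpDr// sqr_ge0.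
  have dn0 : 1 + t ^+ 2 != 0 by rewrite gt_eqF.
  have cs : ((1 - t ^+ 2) / (1 + t ^+ 2)) ^+ 2 + (2 * t / (1 + t ^+ 2)) ^+ 2 = 1 by field.
  have [oH HE] := givens_orth OmT OO OP PO PP cs.
  have := opt _ oH; rewrite -/(f _) HE (fD (1%:M + _ *: Pi) (_ *: Om)) (fD 1%:M (_ *: Pi)) (fZ _ Pi) (fZ _ Om) f1.
  rewrite -subr_ge0 => H.
  rewrite -subr_ge0.
  have -> : 2 * t * f Pi - (1 - t ^+ 2) * f Om = (1 + t ^+ 2) ^+ 2 / (4 * t) *
   (dot z zs - (dot z zs + -2 * (2 * t / (1 + t ^+ 2)) ^+ 2 * f Pi +
      2 * ((1 - t ^+ 2) / (1 + t ^+ 2)) * (2 * t / (1 + t ^+ 2)) * f Om)).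
    by field; rewrite dn0 gt_eqF.
  by rewrite mulr_ge0// divr_ge0 ?sqr_ge0// mulr_ge0// ltW.
have sym i j : f (delta_mx i j) = f (delta_mx j i).
  have [->//|ij] := eqVneq i j.
  have ji : j != i by rewrite eq_sym.
  have := half i j ij; have := half j i ji.
  by rewrite !fB; lra.
move=> A sA; rewrite -/(f A).
have fA (B : 'M[R]_m) : f B = \sum_i \sum_j B i j * f (delta_mx i j).
  rewrite {1}[B]matrix_sum_delta fS; apply: eq_bigr => i _.
  by rewrite fS; apply: eq_bigr => j _; rewrite fZ.
have : f A = - f A.
  rewrite [LHS]fA [f A]fA [LHS]exchange_big -sumrN; apply: eq_bigr => i _ /=.
  rewrite -sumrN; apply: eq_bigr => j _; rewrite sym -mulNr; congr (_ * _).
  by have /matrixP/(_ i j) := sA; rewrite !mxE.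
by lra.
Qed.

End Procrustes.

(** * Rigidity: edge lengths control the distance to the shape *)

Section ShapeDist.
Variables (R : realType) (n nE m : nat) (G : graph n nE).

Lemma special_orthM (P Q : 'M[R]_m) :
  special_orth P -> special_orth Q -> special_orth (P *m Q).
Proof.
move=> [P1 P2] [Q1 Q2]; split.
  by rewrite trmx_mul mulmxA -(mulmxA P) Q1 mulmx1 P1.
by rewrite det_mulmx P2 Q2 mulr1.
Qed.

Lemma desired_shapeP (zs z : 'cV[R]_(nE * m)) :
  desired_shape zs z <-> exists2 Q, special_orth Q & z = brot nE Q *m zs.
Proof. by []. Qed.

(** A quantitative form of the fact that infinitesimal rigidity implies rigidity:
    near the shape, the squared edge lengths control the distance to it.  With
    z0 = Q^T z for the optimal rotation Q and d = z0 - zs, the rigidity matrix maps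
    the displacement to eta = (err - (|d_k|^2)_k) / 2; up to an infinitesimal
    rotation, to which d is orthogonal, a right inverse recovers d from eta.  Hence
    |d| <= K |eta|, and the quadratic term is absorbed when |d| <= 1 / K. *)
Lemma shape_dist (ps : 'cV[R]_(n * m)) : (2 <= n)%N -> inf_min_rigid G ps ->
  exists K r : R, [/\ 0 < K, 0 < r &
   forall (p : 'cV[R]_(n * m)) w, desired_shape (relpos G ps) w ->
     enorm (relpos G p - w) <= r ->
     exists2 w', desired_shape (relpos G ps) w' &
       enorm (relpos G p - w') <= K * enorm (err (relpos G ps) (relpos G p))].
Proof.
move=> n2 rig; set zs := relpos G ps.
have rk : row_free (rigidity G zs).
  by case: rig => -[_ [rk _]]; rewrite /row_free rk.
have [B RB] := row_freeP rk.
have [K0 K00 KP] := opnorm_exists ((ovl m (incidence R G))^T *m B).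
pose K := K0 + 1.
have Kp : 0 < K by rewrite /K; lra.
(* K = K0 + 1 rather than K0, which may vanish *)
exists K, K^-1; split; rewrite ?invr_gt0// => p w /desired_shapeP[Qw oQw wE] pw.
set z := relpos G p in pw *.
have [Q oQ Qmin] := closest_rotation z zs.
exists (brot nE Q *m zs); first by exists Q.
have QQ := orth_trmxK oQ.1.
have QQt : Q^T^T *m Q^T = 1%:M by rewrite trmxK; exact: oQ.1.
set z0 := brot nE Q^T *m z.
have zz0 : z = brot nE Q *m z0 by rewrite /z0 -{1}[Q]trmxK brotK.
pose d := z0 - zs.
have normd : enorm (z - brot nE Q *m zs) = enorm d.
  by rewrite zz0 -mulmxBr enorm_brot.
have opt A : skew_symmetric A -> dot d (brot nE A *m zs) = 0.
  move=> sA; rewrite dotBl (optimal_skew _ sA) => [|H oH].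
    rewrite sub0r dot_blk big1 ?oppr0// => i _.
    by rewrite blk_brot skew_dot.
  have := Qmin _ (special_orthM oQ oH).
  rewrite enorm_le ?enorm_ge0// enorm_sqr {1 2}zz0 -brotM -!mulmxA -!mulmxBr.
  rewrite zz0 -!mulmxBr !dot_brot// !(dotBl, dotBr) (dot_brot zs zs (orth_trmxK oH.1)).
  rewrite (dotC (brot nE H *m zs)) (dotC zs z0); lra.
pose q := brot n Q^T *m p.
pose dp := q - ps.
have dE : d = relpos G dp by rewrite /dp relposB /q relpos_brot.
pose eta := (Dmx zs)^T *m d.
have etaE : rigidity G zs *m dp = eta by rewrite rigidityE -dE.
have [A sA AE] : exists2 A, skew_symmetric A & relpos G (dp - B *m eta) = brot nE A *m zs.
  apply: rigid_kernel => //.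
  by rewrite mulmxBr etaE mulmxA RB mul1mx subrr.
have d1 : enorm d <= K * enorm eta.
  have : enorm d * enorm d <= enorm d * (K * enorm eta).
    rewrite -expr2 enorm_sqr.
    have {2}-> : d = relpos G (B *m eta) + brot nE A *m zs.
      by rewrite -AE -relposD addrC subrK.
    rewrite dotDr opt// addr0.
    apply: le_trans (dot_le _ _) _; rewrite ler_wpM2l ?enorm_ge0//.
    rewrite /relpos mulmxA; apply: le_trans (KP _) _.
    by rewrite ler_wpM2r ?enorm_ge0// /K; lra.
  have [d0|d0] := eqVneq (enorm d) 0; first by rewrite d0 mulr_ge0 ?enorm_ge0// ltW.
  by rewrite ler_pM2l// lt_def d0 enorm_ge0.
have etaE2 : eta = 2^-1 *: (err zs z - (Dmx d)^T *m d).
  have -> : err zs z = err zs z0 by rewrite zz0 err_brot.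
  apply/colP => k; rewrite Dmx_trmul mxE mxE errE [(- _ : 'cV__) _ _]mxE Dmx_trmul.
  have -> : blk z0 k = blk zs k + blk d k by rewrite blkB addrC subrK.
  rewrite !(dotDl, dotDr) (dotC (blk d k) (blk zs k)). by field.
have eta1 : enorm eta <= 2^-1 * (enorm (err zs z) + enorm d * enorm d).
  rewrite etaE2 enormZ ger0_norm ?invr_ge0// ler_wpM2l ?invr_ge0//.
  apply: le_trans (enormB _ _) _; rewrite lerD2l; exact: Dmx_trmul_le.
have dr : enorm d <= K^-1.
  by rewrite -normd; apply: le_trans pw; rewrite wE; exact: Qmin.
rewrite normd.
have Kd : K * enorm d <= 1.
  by rewrite -(mulfV (lt0r_neq0 Kp)) ler_wpM2l// ltW.
have h : K * (enorm d * enorm d) <= enorm d.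
  by rewrite mulrA ler_piMl ?enorm_ge0.
have := le_trans d1 (ler_wpM2l (ltW Kp) eta1).
by rewrite mulrCA mulrDr; move: h; lra.
Qed.

End ShapeDist.

(** * Curves, coordinate by coordinate *)

Section CoordCalculus.
Variable R : realType.

(** Limits and derivatives of curves are handled coordinate by coordinate, so that
    they reduce to those of real functions; coord_cvgP and coord_deriveP relate
    them to the ones in the normed space. *)
Definition coord_cvg (F : set_system R) (k : nat) (x : R -> 'cV[R]_k) (l : 'cV[R]_k) :=
  forall i, x s i ord0 @[s --> F] --> l i ord0.

Definition coord_derive (t : R) (k : nat) (x : R -> 'cV[R]_k) (dx : 'cV[R]_k) :=
  forall i, is_derive t 1 (fun s => x s i ord0) (dx i ord0).

Section Cvg.
Variables (F : set_system R).
Hypothesis FF : Filter F.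

Lemma coord_cvg_cst k (x : 'cV[R]_k) : coord_cvg F (fun=> x) x.
Proof. by move=> i; exact: cvg_cst. Qed.

Lemma coord_cvgD k (x y : R -> 'cV[R]_k) a b :
  coord_cvg F x a -> coord_cvg F y b -> coord_cvg F (fun s => x s + y s) (a + b).
Proof.
move=> xa yb i; rewrite mxE; under eq_cvg do rewrite mxE.
by apply: cvgD; [exact: xa|exact: yb].
Qed.

Lemma coord_cvgN k (x : R -> 'cV[R]_k) a : coord_cvg F x a -> coord_cvg F (fun s => - x s) (- a).
Proof.
move=> xa i; rewrite mxE; under eq_cvg do rewrite mxE.
by apply: cvgN; exact: xa.
Qed.

Lemma coord_cvgB k (x y : R -> 'cV[R]_k) a b :
  coord_cvg F x a -> coord_cvg F y b -> coord_cvg F (fun s => x s - y s) (a - b).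
Proof. by move=> xa yb; apply: coord_cvgD => //; exact: coord_cvgN. Qed.

Lemma cvg_bigsum (I : finType) (f : I -> R -> R) (a : I -> R) :
  (forall i, f i s @[s --> F] --> a i) -> (\sum_i f i s) @[s --> F] --> \sum_i a i.
Proof. by move=> fa; apply: cvg_big => //; exact: add_continuous. Qed.

Lemma cvg_dot k (x y : R -> 'cV[R]_k) a b :
  coord_cvg F x a -> coord_cvg F y b -> dot (x s) (y s) @[s --> F] --> dot a b.
Proof.
by move=> xa yb; apply: cvg_bigsum => i; apply: cvgM; [exact: xa|exact: yb].
Qed.

Lemma coord_cvg_mulmx k l (A : 'M[R]_(l, k)) (x : R -> 'cV[R]_k) a :
  coord_cvg F x a -> coord_cvg F (fun s => A *m x s) (A *m a).
Proof.
move=> xa i; rewrite mxE; under eq_cvg do rewrite mxE.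
by apply: cvg_bigsum => j; apply: cvgM; [exact: cvg_cst|exact: xa].
Qed.

Lemma coord_cvg_col k l (x : R -> 'cV[R]_k) (y : R -> 'cV[R]_l) a b :
  coord_cvg F x a -> coord_cvg F y b -> coord_cvg F (fun s => col_mx (x s) (y s)) (col_mx a b).
Proof.
move=> xa yb i; rewrite mxE; under eq_cvg do rewrite mxE.
by case: (fintype.split i) => j; [exact: xa|exact: yb].
Qed.

Lemma coord_cvg_err k m (zs : 'cV[R]_(k * m)) (z : R -> 'cV[R]_(k * m)) a :
  coord_cvg F z a -> coord_cvg F (fun s => err zs (z s)) (err zs a).
Proof.
move=> za i; rewrite errE; under eq_cvg do rewrite errE.
have zi : coord_cvg F (fun s => blk (z s) i) (blk a i).
  by move=> j; rewrite mxE; under eq_cvg do rewrite mxE; exact: za.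
by apply: cvgB; [exact: cvg_dot|exact: cvg_cst].
Qed.

Lemma coord_cvgP k (x : R -> 'cV[R]_k) a : coord_cvg F x a <-> (x s @[s --> F] --> a).
Proof.
split=> [xa|xa i].
  apply/(@cvgrPdist_le _ _ _ _ FF) => e e0; near=> s.
  apply/mx_norm_leP; first exact: ltW.
  move=> i j; rewrite !mxE (ord1 j); move: i; near: s.
  apply: filter_forall => i.
  exact: ((@cvgrPdist_le _ _ _ _ FF _ _).1 (xa i) e e0).
apply: (@cvg_comp _ _ _ x (fun M : 'cV[R]_k => M i ord0)); first exact: xa.
exact: coord_continuous.
Unshelve. all: by end_near. Qed.

End Cvg.

Section Der.
Variable t : R.

Lemma coord_deriveP k (x : R -> 'cV[R]_k) dx : coord_derive t x dx <-> is_derive t 1 x dx.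
Proof.
split=> [H|H i].
  by apply/is_derive_mxP => i j; rewrite (ord1 j); exact: H.
exact: ((is_derive_mxP x t dx).1 H i ord0).
Qed.

Lemma coord_derive_cvg k (x : R -> 'cV[R]_k) dx : coord_derive t x dx -> coord_cvg (nbhs t) x (x t).
Proof. by move=> H i; exact: (is_derive_continuous (H i)). Qed.

Lemma is_derive_ext (f g : R -> R) (d d' : R) : is_derive t 1 f d ->
  (forall s, f s = g s) -> d = d' -> is_derive t 1 g d'.
Proof. by move=> H fg <-; have <- : f = g by apply/funext. Qed.

Lemma coord_derive_cst k (x : 'cV[R]_k) : coord_derive t (fun=> x) 0.
Proof. by move=> i; rewrite mxE; exact: is_derive_cst. Qed.

Lemma coord_deriveD k (x y : R -> 'cV[R]_k) dx dy :
  coord_derive t x dx -> coord_derive t y dy -> coord_derive t (fun s => x s + y s) (dx + dy).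
Proof.
move=> H1 H2 i; have h1 := H1 i; have h2 := H2 i.
apply: is_derive_ext (is_deriveD h1 h2) _ _; last by rewrite mxE.
by move=> s; rewrite mxE.
Qed.

Lemma coord_deriveN k (x : R -> 'cV[R]_k) dx : coord_derive t x dx -> coord_derive t (fun s => - x s) (- dx).
Proof.
move=> H1 i; have h1 := H1 i.
apply: is_derive_ext (is_deriveN h1) _ _; last by rewrite mxE.
by move=> s; rewrite mxE.
Qed.

Lemma coord_deriveB k (x y : R -> 'cV[R]_k) dx dy :
  coord_derive t x dx -> coord_derive t y dy -> coord_derive t (fun s => x s - y s) (dx - dy).
Proof. by move=> H1 H2; apply: coord_deriveD => //; exact: coord_deriveN. Qed.

Lemma is_derive_bigsum k (f : 'I_k -> R -> R) (d : 'I_k -> R) :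
  (forall i, is_derive t 1 (f i) (d i)) ->
  is_derive t 1 (fun s => \sum_i f i s) (\sum_i d i).
Proof.
move=> H; apply: is_derive_ext (is_derive_sum H) _ (erefl _).
by move=> s; rewrite fct_sumE.
Qed.

Lemma is_derive_dot k (x y : R -> 'cV[R]_k) dx dy :
  coord_derive t x dx -> coord_derive t y dy ->
  is_derive t 1 (fun s => dot (x s) (y s)) (dot (x t) dy + dot (y t) dx).
Proof.
move=> H1 H2; rewrite -big_split /=; apply: is_derive_bigsum => i.
have h1 := H1 i; have h2 := H2 i.
exact: (is_deriveM h1 h2).
Qed.

Lemma coord_derive_mulmx k l (A : 'M[R]_(l, k)) (x : R -> 'cV[R]_k) dx :
  coord_derive t x dx -> coord_derive t (fun s => A *m x s) (A *m dx).
Proof.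
move=> H i; rewrite mxE.
have -> : (fun s => (A *m x s) i ord0) = (fun s => \sum_j A i j * x s j ord0).
  by apply/funext => s; rewrite mxE.
apply: is_derive_bigsum => j; have h := H j.
exact: (is_deriveZ (A i j) h).
Qed.

Lemma coord_derive_col k l (x : R -> 'cV[R]_k) (y : R -> 'cV[R]_l) dx dy :
  coord_derive t x dx -> coord_derive t y dy -> coord_derive t (fun s => col_mx (x s) (y s)) (col_mx dx dy).
Proof.
move=> H1 H2 i; rewrite mxE.
have -> : (fun s => col_mx (x s) (y s) i ord0) = fun s =>
    match fintype.split i with inl j => x s j ord0 | inr j => y s j ord0 end.
  by apply/funext => s; rewrite mxE.
by case: (fintype.split i) => j; [exact: H1|exact: H2].
Qed.

Lemma coord_derive_err k m (zs : 'cV[R]_(k * m)) (z : R -> 'cV[R]_(k * m)) dz :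
  coord_derive t z dz -> coord_derive t (fun s => err zs (z s)) (2 *: ((Dmx (z t))^T *m dz)).
Proof.
move=> H i; rewrite mxE Dmx_trmul.
have zi : coord_derive t (fun s => blk (z s) i) (blk dz i).
  by move=> j; rewrite mxE; apply: is_derive_ext (H _) _ (erefl _) => s; rewrite mxE.
have h := is_derive_dot zi zi.
have c := is_derive_cst (dot (blk zs i) (blk zs i)) t (1 : R).
apply: is_derive_ext (is_deriveB h c) _ _; last by ring.
by move=> s; rewrite errE.
Qed.

End Der.

(** At the infimum tau of the times where phi >= rho, phi is still < rho by the
    inductive hypothesis, and remains so shortly after. *)
Lemma continuity_induction (phi : R -> R) (T : \bar R) (rho : R) :
  phi s @[s --> 0^'+] --> phi 0 ->
  (forall t : R, 0 < t -> (t%:E < T)%E -> {for t, continuous phi}) ->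
  phi 0 < rho ->
  (forall t : R, 0 <= t -> (t%:E < T)%E ->
     (forall s : R, 0 <= s <= t -> phi s <= rho) -> phi t < rho) ->
  forall t : R, 0 <= t -> (t%:E < T)%E -> phi t < rho.
Proof.
move=> c0 ct p0 step t t0 tT; rewrite ltNge; apply/negP => pt.
pose A := [set s : R | 0 <= s <= t /\ rho <= phi s].
have At : A t by split; rewrite ?t0 ?lexx.
have lbA : has_lbound A by exists 0 => s [/andP[]].
have iA : has_inf A by split => //; exists t.
pose tau := inf A.
have taut : tau <= t by exact: ge_inf.
have tau0 : 0 <= tau by apply: lb_le_inf; [exists t|move=> s [/andP[]]].
have below (s : R) : 0 <= s -> s < tau -> phi s < rho.
  move=> s0 st; rewrite ltNge; apply/negP => ps.
  have : tau <= s.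
    by apply: ge_inf => //; split => //; rewrite s0 (le_trans (ltW st)).
  by rewrite leNgt st.
have tauT : (tau%:E < T)%E by apply: le_lt_trans tT; rewrite lee_fin.
have ptau : phi tau <= rho.
  have [tau00|taup] := eqVneq tau 0; first by rewrite tau00 ltW.
  have taup' : 0 < tau by rewrite lt_def taup tau0.
  have c := ct tau taup' tauT.
  have cl : phi s @[s --> tau^'-] --> phi tau by exact: cvg_at_left_filter.
  apply: (cvgr_to_le cl); near=> s.
  apply/ltW/below; last by near: s; exact: nbhs_left_lt.
  by apply/ltW; near: s; exact: nbhs_left_gt.
have ptau' : phi tau < rho.
  apply: step => // s /andP[s0]; rewrite le_eqVlt => /predU1P[->//|st].
  exact/ltW/below.
have cr : phi s @[s --> tau^'+] --> phi tau.
  have [tau00|taup] := eqVneq tau 0; first by rewrite tau00.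
  have taup' : 0 < tau by rewrite lt_def taup tau0.
  by have c := ct tau taup' tauT; exact: cvg_at_right_filter.
have [e /= e0 He] := cvgr_lt _ cr _ ptau'.
have [s [sA sr] se] := inf_adherent e0 iA.
have taus : tau <= s by exact: ge_inf.
move: taus; rewrite le_eqVlt => /predU1P[taus|taus].
  by move: sr; rewrite -taus leNgt ptau'.
have : phi s < rho.
  by apply: He => //=; rewrite ltr0_norm ?subr_lt0// opprB ltrBlDl.
by rewrite ltNge sr.
Unshelve. all: by end_near. Qed.

End CoordCalculus.

(** * The Lyapunov estimate *)

Section Estimate.
Variables (R : realType).

Lemma enorm_col_le k l (x : 'cV[R]_k) (y : 'cV[R]_l) :
  enorm (col_mx x y) <= enorm x + enorm y.
Proof.
rewrite enorm_le ?addr_ge0 ?enorm_ge0// dot_col_mx sqrrD !enorm_sqr.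
by rewrite addrAC lerDl mulrn_wge0// mulr_ge0 ?enorm_ge0.
Qed.

Lemma enorm_colu k l (x : 'cV[R]_k) (y : 'cV[R]_l) : enorm x <= enorm (col_mx x y).
Proof. by rewrite enorm_le ?enorm_ge0// enorm_sqr dot_col_mx lerDl dot_ge0. Qed.

Lemma enorm_cold k l (x : 'cV[R]_k) (y : 'cV[R]_l) : enorm y <= enorm (col_mx x y).
Proof. by rewrite enorm_le ?enorm_ge0// enorm_sqr dot_col_mx lerDr dot_ge0. Qed.

Lemma ovlB (k l m : nat) (A B : 'M[R]_(k, l)) : ovl m (A - B) = ovl m A - ovl m B.
Proof.
apply/matrixP => r c; case: (mxtens_indexP r) => i b; case: (mxtens_indexP c) => j d.
by rewrite tensmxE [(A - B) _ _]mxE [(- B) _ _]mxE mulrBl [RHS]mxE [(- ovl m B) _ _]mxE !tensmxE.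
Qed.

Variables (n nE m : nat) (G : graph n nE).
Notation BB := (ovl m (incidence R G)).
Notation SS1 := (ovl m (S1mx R G)).
Notation SS2 := (ovl m (S2mx R G)).

(** With a the decay rate of P along F, the part of the perturbation due to z - zs
    costs a / 4 when rho is small, and the cross terms Kc |x| |y| between the slow
    and the fast variable cost a / 4 of |x|^2 and Kc^2 / a of |y|^2; the gain has to
    exceed the latter.  The constants a, Kc and rho do not depend on the gain. *)
Lemma lyap_estimate (zs : 'cV[R]_(nE * m)) : hurwitz (Fmx G zs) ->
  exists kappas : R, 0 < kappas /\ forall kappa : R, kappas < kappa ->
  exists (P : 'M[R]_(n * m + nE)) (lam rho c1 c2 : R),
  [/\ P^T = P, [/\ 0 < lam, 0 < rho, rho <= 1, 0 < c1 & 0 < c2],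
    (forall (x : 'cV[R]_(n * m + nE)) (y : 'cV[R]_nE),
      c1 * (dot x x + dot y y) <= dot x (P *m x) + dot y y <= c2 * (dot x x + dot y y)) &
    forall z (v : 'cV[R]_(n * m)) (e y : 'cV[R]_nE) dv de x, enorm (z - zs) <= rho ->
      dv = - v - BB *m Dmx z *m e + SS1 *m Dmx z *m (y + e) ->
      de = 2 *: ((Dmx z)^T *m BB^T *m v) ->
      x = col_mx v e ->
      dot x (P *m col_mx dv de) + dot y (- kappa *: y - de) <=
        - lam * (dot x (P *m x) + dot y y)].
Proof.
move=> hF; have [P [a [a0 PT Plow PF]]] := lyapunov hF.
have [p p0 pP] := opnorm_exists P.
have [kb kb0 kbP] := opnorm_exists BB^T.
have [k1 k10 k1P] := opnorm_exists SS1.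
have [k2 k20 k2P] := opnorm_exists SS2.
pose zm := enorm zs + 1.
have zm0 : 0 <= zm by rewrite addr_ge0 ?enorm_ge0.
pose c3 := k2 + 2 * kb.
have c30 : 0 <= c3 by rewrite addr_ge0// mulr_ge0.
pose Kc := p * (k1 * zm) + 2 * zm * kb.
have Kc0 : 0 <= Kc by rewrite addr_ge0 ?mulr_ge0.
(* the summand 1 keeps the denominator positive when p c3 = 0 *)
pose rho := Num.min 1 (a / (4 * (p * c3 + 1))).
have pc0 : 0 <= p * c3 by rewrite mulr_ge0.
have den0 : 0 < 4 * (p * c3 + 1) by lra.
have rho0 : 0 < rho by rewrite lt_min ltr01 divr_gt0.
have rho1 : rho <= 1 by rewrite ge_min lexx.
have rhoa : p * c3 * rho <= a / 4.
  have : rho * (4 * (p * c3 + 1)) <= a.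
    by rewrite -ler_pdivlMr// ge_min lexx orbT.
  lra.
exists (Kc ^+ 2 / a + a); split; first by rewrite ltr_wpDl// divr_ge0 ?sqr_ge0// ltW.
move=> kappa hk.
pose lam := a / (2 * (p + 1)).
have p1 : 0 < 2 * (p + 1) by lra.
have lam0 : 0 < lam by rewrite divr_gt0.
have xPx x : dot x (P *m x) <= p * dot x x.
  apply: le_trans (dot_le _ _) _; rewrite -enorm_sqr expr2 mulrCA.
  by rewrite ler_wpM2l ?enorm_ge0.
exists P, lam, rho, (Num.min a 1), (p + 1); split => //.
- by split => //; [rewrite lt_min a0 ltr01|lra].
- move=> x y; have := Plow x; have := xPx x; have := dot_ge0 x; have := dot_ge0 y.
  move=> y0 x0 h1 h2; apply/andP; split; last first.
    by have := mulr_ge0 p0 y0; lra.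
  rewrite mulrDr; apply: lerD.
    by apply: le_trans h2; rewrite ler_wpM2r// ge_min lexx.
  by rewrite -[leRHS]mul1r ler_wpM2r// ge_min lexx orbT.
move=> z v e y dv de x hz dvE deE xvE.
pose d := z - zs.
have zE : z = zs + d by rewrite addrC subrK.
have nz : enorm z <= zm.
  by rewrite zE; apply: le_trans (enormD _ _) _; rewrite lerD2l (le_trans hz).
have nv : enorm v <= enorm x by rewrite xvE; exact: enorm_colu.
have ne : enorm e <= enorm x by rewrite xvE; exact: enorm_cold.
pose r := col_mx (- (SS2 *m (Dmx d *m e)) + SS1 *m (Dmx z *m y)) (2 *: ((Dmx d)^T *m (BB^T *m v))).
have xE : col_mx dv de = Fmx G zs *m x + r.
  rewrite xvE /Fmx mul_block_col add_col_mx; congr col_mx.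
    rewrite dvE mulmxDr -!mulmxA /S2mx ovlB zE !DmxD; move: (S1mx R G) => S.
    rewrite !mulNmx mul1mx !mulmxBl !mulmxDl !mulmxDr.
    rewrite -!mulmxA.
    by apply/colP => i; rewrite !mxE; ring.
  rewrite mul0mx addr0 deE zE DmxD linearD/= !mulmxDl scalerDr -scalemxAl.
  by rewrite !mulmxA.
have nr : enorm r <= rho * c3 * enorm x + k1 * zm * enorm y.
  apply: le_trans (enorm_col_le _ _) _.
  have h1 : enorm (- (SS2 *m (Dmx d *m e)) + SS1 *m (Dmx z *m y)) <=
      k2 * (rho * enorm x) + k1 * (zm * enorm y).
    apply: le_trans (enormD _ _) _; rewrite enormN; apply: lerD.
      apply: le_trans (k2P _) _; rewrite ler_wpM2l//.
      by apply: le_trans (Dmx_mul_le _ _) _; apply: ler_pM; rewrite ?enorm_ge0.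
    apply: le_trans (k1P _) _; rewrite ler_wpM2l//.
    by apply: le_trans (Dmx_mul_le _ _) _; apply: ler_pM; rewrite ?enorm_ge0.
  have h2 : enorm (2 *: ((Dmx d)^T *m (BB^T *m v))) <= 2 * (rho * (kb * enorm x)).
    rewrite enormZ ger0_norm// ler_wpM2l//.
    apply: le_trans (Dmx_trmul_le _ _) _; apply: ler_pM; rewrite ?enorm_ge0//.
    by apply: le_trans (kbP _) _; rewrite ler_wpM2l.
  by rewrite /c3; move: h1 h2; lra.
have nde : enorm de <= 2 * (zm * (kb * enorm x)).
  rewrite deE -mulmxA enormZ ger0_norm// ler_wpM2l//.
  apply: le_trans (Dmx_trmul_le _ _) _; apply: ler_pM; rewrite ?enorm_ge0//.
  by apply: le_trans (kbP _) _; rewrite ler_wpM2l.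
rewrite xE mulmxDr dotDr dotBr dotZr.
have h1 := PF x.
have h2 : dot x (P *m r) <= p * (rho * c3 * enorm x + k1 * zm * enorm y) * enorm x.
  apply: le_trans (dot_le _ _) _; rewrite mulrC ler_wpM2r ?enorm_ge0//.
  by apply: le_trans (pP _) _; rewrite ler_wpM2l.
have h3 : - dot y de <= enorm y * (2 * (zm * (kb * enorm x))).
  rewrite -dotNr; apply: le_trans (dot_le _ _) _; rewrite enormN.
  by rewrite ler_wpM2l ?enorm_ge0.
have h4 : dot x (P *m x) + dot y y <= (p + 1) * (dot x x + dot y y).
  have := xPx x; have := mulr_ge0 p0 (dot_ge0 y); have := dot_ge0 x; lra.
have h5 : lam * (dot x (P *m x) + dot y y) <= a / 2 * (dot x x + dot y y).
  apply: le_trans (ler_wpM2l (ltW lam0) h4) _; rewrite mulrA.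
  have -> : lam * (p + 1) = a / 2 by rewrite /lam; field; lra.
  by [].
rewrite mulNr.
move: h1 h2 h3 h5; rewrite -!(enorm_sqr x) -!(enorm_sqr y).
move: (enorm_ge0 x) (enorm_ge0 y) nv ne; move: (enorm x) (enorm y) => X Y X0 Y0 _ _.
move: (dot x _) (dot x _) (dot x _) (dot y de) => q1 q2 q3 q4 h1 h2 h3 h5.
have g1 : p * c3 * rho * X ^+ 2 <= a / 4 * X ^+ 2 by rewrite ler_wpM2r ?sqr_ge0.
have g2 : Kc * X * Y <= a / 4 * X ^+ 2 + Kc ^+ 2 / a * Y ^+ 2.
  have -> : Kc ^+ 2 / a * Y ^+ 2 = a * ((Kc / a) * Y) ^+ 2 by field; lra.
  have -> : Kc * X * Y = a * X * ((Kc / a) * Y) by field; lra.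
  have := mulr_ge0 (ltW a0) (sqr_ge0 (X / 2 - Kc / a * Y)).
  by lra.
have g3 : (Kc ^+ 2 / a + a) * Y ^+ 2 <= kappa * Y ^+ 2.
  by rewrite ler_wpM2r ?sqr_ge0// ltW.
have g4 : 0 <= a * Y ^+ 2 by rewrite mulr_ge0 ?sqr_ge0// ltW.
have {}g2 : (p * (k1 * zm) + 2 * zm * kb) * X * Y <=
  a / 4 * X ^+ 2 + Kc ^+ 2 / a * Y ^+ 2 by [].
move: (Kc ^+ 2 / a) g2 g3 => K' g2 g3.
lra.
Qed.

End Estimate.

(** * Trapping and decay of trajectories *)

Section Trajectories.
Variables (R : realType) (n nE m : nat) (G : graph n nE).
Notation BB := (ovl m (incidence R G)).
Notation SS1 := (ovl m (S1mx R G)).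
Variables (zs : 'cV[R]_(nE * m)) (mu : 'cV[R]_nE) (kappa : R).

Definition vfield (v : 'cV[R]_(n * m)) (z : 'cV[R]_(nE * m)) (muh : 'cV[R]_nE) :=
  - v - BB *m Dmx z *m err zs z - SS1 *m Dmx z *m (mu - muh).

Definition flow_at (t : R) (v : R -> 'cV[R]_(n * m)) (z : R -> 'cV[R]_(nE * m))
    (muh : R -> 'cV[R]_nE) :=
  [/\ coord_derive t v (vfield (v t) (z t) (muh t)),
      coord_derive t z (BB^T *m v t) &
      coord_derive t muh (kappa *: (err zs (z t) + mu - muh t))].

(** Squared distance of the state to the equilibrium (0, zs, mu). *)
Definition sqdist (v : 'cV[R]_(n * m)) (z : 'cV[R]_(nE * m)) (muh : 'cV[R]_nE) :=
  dot v v + dot (z - zs) (z - zs) + dot (muh - mu) (muh - mu).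

Definition state_norm (v : 'cV[R]_(n * m)) (z : 'cV[R]_(nE * m)) (muh : 'cV[R]_nE) :=
  enorm (col_mx v (col_mx (err zs z) (muh - mu))).

Definition right_cont (v : R -> 'cV[R]_(n * m)) (z : R -> 'cV[R]_(nE * m))
    (muh : R -> 'cV[R]_nE) :=
  [/\ coord_cvg 0^'+ v (v 0), coord_cvg 0^'+ z (z 0) & coord_cvg 0^'+ muh (muh 0)].

Lemma err_le (z : 'cV[R]_(nE * m)) : enorm (z - zs) <= 1 ->
  enorm (err zs z) <= (2 * enorm zs + 1) * enorm (z - zs).
Proof.
set d := z - zs => d1.
have -> : err zs z = 2 *: ((Dmx zs)^T *m d) + (Dmx d)^T *m d.
  apply/colP => k; rewrite errE mxE [X in _ = X + _]mxE !Dmx_trmul.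
  have -> : blk z k = blk zs k + blk d k by rewrite blkB addrC subrK.
  rewrite !(dotDl, dotDr) (dotC (blk d k) (blk zs k)); ring.
apply: le_trans (enormD _ _) _; rewrite mulrDl; apply: lerD.
  by rewrite enormZ ger0_norm// -mulrA ler_wpM2l// Dmx_trmul_le.
by apply: le_trans (Dmx_trmul_le _ _) _; rewrite ler_wpM2r ?enorm_ge0.
Qed.

Variables (P : 'M[R]_(n * m + nE)) (lam rho c1 c2 : R).
Hypotheses (PT : P^T = P) (lam0 : 0 < lam) (rho0 : 0 < rho) (rho1 : rho <= 1)
  (c10 : 0 < c1) (c20 : 0 < c2).
Hypothesis Vequiv : forall (x : 'cV[R]_(n * m + nE)) (y : 'cV[R]_nE),
  c1 * (dot x x + dot y y) <= dot x (P *m x) + dot y y <= c2 * (dot x x + dot y y).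
Hypothesis Vdecr : forall z (v : 'cV[R]_(n * m)) (e y : 'cV[R]_nE) dv de x,
  enorm (z - zs) <= rho ->
  dv = - v - BB *m Dmx z *m e + SS1 *m Dmx z *m (y + e) ->
  de = 2 *: ((Dmx z)^T *m BB^T *m v) ->
  x = col_mx v e ->
  dot x (P *m col_mx dv de) + dot y (- kappa *: y - de) <=
    - lam * (dot x (P *m x) + dot y y).

(* C0 ^ 2 >= 9 c2 / c1, the factor that bounds squared norms *)
Let C0 := 9 * c2 / c1 + 1.

Lemma C0_gt0 : 0 < C0.
Proof. by rewrite ltr_wpDl// divr_ge0 ?mulr_ge0// ltW. Qed.

(** Gronwall's inequality for V = x^T P x + |y|^2; the factor 9 comes from passing
    between the coordinates (v, e, muh - mu) and (v, e, y), each way at the cost of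
    a factor 3 on squared norms. *)
Lemma decay (b : R) v z muh : 0 <= b -> right_cont v z muh ->
  (forall t : R, 0 < t <= b -> flow_at t v z muh) ->
  (forall t : R, 0 < t <= b -> enorm (z t - zs) <= rho) ->
  state_norm (v b) (z b) (muh b) <=
    C0 * expR (- lam * b) * state_norm (v 0) (z 0) (muh 0).
Proof.
move=> b0 [cv cz cm] fl near.
pose e t := err zs (z t).
pose x t := col_mx (v t) (e t).
pose y t := (muh t - mu) - e t.
pose V t := dot (x t) (P *m x t) + dot (y t) (y t).
have ce : coord_cvg 0^'+ e (e 0) by exact: coord_cvg_err.
have cx : coord_cvg 0^'+ x (x 0) by exact: coord_cvg_col.
have cy : coord_cvg 0^'+ y (y 0) by apply: coord_cvgB => //; apply: coord_cvgB => //; exact: coord_cvg_cst.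
have cV : V t @[t --> 0^'+] --> V 0.
  by apply: cvgD; [apply: cvg_dot => //; exact: coord_cvg_mulmx|exact: cvg_dot].
pose dv t := vfield (v t) (z t) (muh t).
pose de t := 2 *: ((Dmx (z t))^T *m (BB^T *m v t)).
pose dy t := - kappa *: y t - de t.
pose dV t := 2 * (dot (x t) (P *m col_mx (dv t) (de t)) + dot (y t) (dy t)).
have Vd t : 0 < t <= b -> is_derive t 1 V (dV t).
  move=> tb; have [fv fz fm] := fl t tb.
  have fe : coord_derive t e (de t) by exact: coord_derive_err.
  have fx : coord_derive t x (col_mx (dv t) (de t)) by exact: coord_derive_col.
  have fy : coord_derive t y (dy t).
    have -> : dy t = kappa *: (err zs (z t) + mu - muh t) - 0 - de t.
      by rewrite /dy /y /e; apply/colP => i; rewrite !mxE; ring.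
    by apply: coord_deriveB => //; apply: coord_deriveB => //; exact: coord_derive_cst.
  have h1 := is_derive_dot fx (coord_derive_mulmx P fx).
  have h2 := is_derive_dot fy fy.
  apply: is_derive_ext (is_deriveD h1 h2) _ _ => [//|].
  have -> : dot (P *m x t) (col_mx (dv t) (de t)) = dot (x t) (P *m col_mx (dv t) (de t)).
    by rewrite [RHS]dot_trmx PT.
  by rewrite /dV; ring.
have dVle t : 0 < t <= b -> dV t <= - (2 * lam) * V t.
  move=> tb; have := @Vdecr (z t) (v t) (e t) (y t) (dv t) (de t) (x t) (near t tb).
  move=> H; rewrite /dV -mulrN -mulrA ler_wpM2l//.
  apply: H => //; last by rewrite /de mulmxA.
  by rewrite /dv /vfield /y subrK -[mu - _]opprB mulmxN opprK.
have Vb := gronwall b0 cV Vd dVle.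
pose M t := dot (x t) (x t) + dot (y t) (y t).
pose N t := dot (v t) (v t) + (dot (e t) (e t) + dot (muh t - mu) (muh t - mu)).
have NE t : state_norm (v t) (z t) (muh t) ^+ 2 = N t.
  by rewrite enorm_sqr !dot_col_mx.
have sq (k : nat) (p q : 'cV[R]_k) : dot (p + q) (p + q) <= 2 * dot p p + 2 * dot q q.
  have := dot_ge0 (p - q); rewrite !(dotDl, dotDr, dotBl, dotBr, dotNl, dotNr) (dotC q p); lra.
have NM t : N t <= 3 * M t.
  rewrite /N /M /x dot_col_mx; have := sq _ (y t) (e t).
  rewrite {1 2}/y subrK; have := dot_ge0 (v t); have := dot_ge0 (y t).
  have := dot_ge0 (e t); lra.
have MN t : M t <= 3 * N t.
  rewrite /N /M /x dot_col_mx; have := sq _ (muh t - mu) (- e t).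
  rewrite -/(y t) dotNl dotNr opprK; have := dot_ge0 (v t).
  have := dot_ge0 (e t); have := dot_ge0 (muh t - mu); lra.
have N0 t : 0 <= N t by rewrite !addr_ge0 ?dot_ge0.
have Nb : N b <= 9 * c2 / c1 * (expR (- lam * b) ^+ 2 * N 0).
  have E : expR (- (2 * lam) * b) = expR (- lam * b) ^+ 2.
    by rewrite expr2 -expRD; congr expR; ring.
  rewrite E in Vb.
  have /andP[V1 _] := Vequiv (x b) (y b); have /andP[_ V2] := Vequiv (x 0) (y 0).
  have E0 : 0 <= expR (- lam * b) ^+ 2 by exact: sqr_ge0.
  have h1 : c1 * M b <= c2 * M 0 * expR (- lam * b) ^+ 2.
    by apply: le_trans V1 _; apply: le_trans Vb _; rewrite ler_wpM2r.
  have h2 : c2 * M 0 * expR (- lam * b) ^+ 2 <= c2 * (3 * N 0) * expR (- lam * b) ^+ 2.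
    by rewrite ler_wpM2r// ler_wpM2l ?MN// ltW.
  have h3 : c1 * N b <= 9 * c2 * (expR (- lam * b) ^+ 2 * N 0).
    have := ler_wpM2l (ltW c10) (NM b); have := le_trans h1 h2.
    move: (expR _ ^+ 2) (M b) (N b) (N 0) => E' Mb Nb N0' h h'.
    lra.
  rewrite [leRHS](_ : _ = (9 * c2 * (expR (- lam * b) ^+ 2 * N 0)) / c1).
    by rewrite ler_pdivlMr// mulrC.
  by field; rewrite gt_eqF.
have CE0 : 0 <= C0 * expR (- lam * b) * state_norm (v 0) (z 0) (muh 0).
  by rewrite !mulr_ge0 ?expR_ge0 ?enorm_ge0// ltW// C0_gt0.
rewrite -(@ler_pXn2r _ 2%N) ?nnegrE ?enorm_ge0// NE !exprMn NE -mulrA.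
apply: le_trans Nb _; apply: ler_wpM2r; first by rewrite mulr_ge0 ?sqr_ge0.
rewrite /C0; have : 0 <= 9 * c2 / c1 by rewrite divr_ge0 ?mulr_ge0// ltW.
nra.
Qed.

(** While the state is in the ball of squared radius rho2, the decay of v bounds the
    displacement of z, and the state is in fact in a ball of squared radius
    K5 delta^2 < rho2.  The equations of motion are required only inside the ball,
    so that the statement applies to solutions of the truncated system too. *)
Theorem trapped (rho2 : R) : 0 < rho2 -> rho2 <= rho ^+ 2 ->
  exists delta : R, [/\ 0 < delta, delta <= 1 &
  forall (T : \bar R) v z muh,
    right_cont v z muh ->
    (forall t : R, 0 < t -> (t%:E < T)%E ->
      [/\ coord_cvg (nbhs t) v (v t), coord_cvg (nbhs t) z (z t) & coord_cvg (nbhs t) muh (muh t)]) ->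
    (forall t : R, 0 < t -> (t%:E < T)%E -> sqdist (v t) (z t) (muh t) <= rho2 ->
      flow_at t v z muh) ->
    enorm (v 0) < delta -> enorm (z 0 - zs) < delta -> enorm (muh 0 - mu) < delta ->
    forall t : R, 0 <= t -> (t%:E < T)%E ->
      sqdist (v t) (z t) (muh t) < rho2 /\
      state_norm (v t) (z t) (muh t) <=
        C0 * expR (- lam * t) * state_norm (v 0) (z 0) (muh 0)].
Proof.
move=> r0 rr.
have C00 := C0_gt0.
have [kb kb0 kbP] := opnorm_exists BB^T.
pose K3 := (nE * m)%:R * (kb * C0 / lam).
have K30 : 0 <= K3 by rewrite !mulr_ge0 ?invr_ge0// ltW.
pose K4 := 2 + (2 * enorm zs + 1).
have K40 : 0 <= K4 by rewrite /K4; have := enorm_ge0 zs; lra.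
pose K5 := (C0 * K4) ^+ 2 + (1 + K3 * K4) ^+ 2.
have K50 : 0 <= K5 by rewrite addr_ge0 ?sqr_ge0.
pose delta := Num.min 1 (rho2 / (K5 + 1)).
have K51 : 0 < K5 + 1 by lra.
have delta0 : 0 < delta by rewrite lt_min ltr01 divr_gt0.
have delta1 : delta <= 1 by rewrite ge_min lexx.
have K5d : K5 * delta ^+ 2 < rho2.
  have h : delta * (K5 + 1) <= rho2 by rewrite -ler_pdivlMr// ge_min lexx orbT.
  have h1 : delta ^+ 2 <= delta by rewrite expr2 ler_piMr// ltW.
  have := ler_wpM2l K50 h1; lra.
exists delta; split => // T v z muh rc cont fl v0 z0 m0.
have [cv cz cm] := rc.
pose N0 := state_norm (v 0) (z 0) (muh 0).
have N00 : 0 <= N0 by exact: enorm_ge0.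
have N0K : N0 <= K4 * delta.
  apply: le_trans (enorm_col_le _ _) _; have := enorm_col_le (err zs (z 0)) (muh 0 - mu).
  have : enorm (err zs (z 0)) <= (2 * enorm zs + 1) * delta.
    apply: le_trans (err_le _) _; first by apply: le_trans delta1; exact: ltW.
    by rewrite ler_wpM2l ?ltW// ; have := enorm_ge0 zs; lra.
  rewrite /K4; move: v0 m0; lra.
pose phi t := sqdist (v t) (z t) (muh t).
have phic (F : set_system R) (FF : Filter F) a :
    coord_cvg F v (v a) -> coord_cvg F z (z a) -> coord_cvg F muh (muh a) -> phi t @[t --> F] --> phi a.
  move=> h1 h2 h3.
  have h2' : coord_cvg F (fun t => z t - zs) (z a - zs).
    by apply: coord_cvgB => //; exact: coord_cvg_cst.
  have h3' : coord_cvg F (fun t => muh t - mu) (muh a - mu).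
    by apply: coord_cvgB => //; exact: coord_cvg_cst.
  by apply: cvgD; [apply: cvgD|]; exact: cvg_dot.
have zle t : phi t <= rho2 -> enorm (z t - zs) <= rho.
  move=> ph; rewrite enorm_le ?(ltW rho0)//; apply: le_trans rr; apply: le_trans ph.
  by rewrite /phi /sqdist; have := dot_ge0 (v t); have := dot_ge0 (muh t - mu); lra.
have dec (b : R) : 0 <= b -> (b%:E < T)%E -> (forall s : R, 0 <= s <= b -> phi s <= rho2) ->
    state_norm (v b) (z b) (muh b) <= C0 * expR (- lam * b) * N0.
  move=> b0 bT Hb; apply: decay => // t /andP[t0 tb].
    apply: fl => //; first by apply: le_lt_trans bT; rewrite lee_fin.
    by apply: Hb; rewrite (ltW t0).
  by apply: zle; apply: Hb; rewrite (ltW t0).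
have step (b : R) : 0 <= b -> (b%:E < T)%E -> (forall s : R, 0 <= s <= b -> phi s <= rho2) ->
    phi b < rho2.
  move=> b0 bT Hb.
  have decs (s : R) : 0 <= s <= b -> state_norm (v s) (z s) (muh s) <= C0 * expR (- lam * s) * N0.
    move=> /andP[s0 sb]; apply: dec => //.
      by apply: le_lt_trans bT; rewrite lee_fin.
    by move=> u /andP[u0 us]; apply: Hb; rewrite u0 (le_trans us).
  have zmove : enorm (z b - z 0) <= K3 * N0.
    rewrite /K3 -mulrA; apply: enorm_le_coord.
      by rewrite !mulr_ge0 ?invr_ge0// ltW.
    move=> i; rewrite [(z b - z 0) i ord0]mxE [(- z 0) i ord0]mxE.
    (* |z_i'| <= A exp (- lam t), whose integral is at most A / lam *)
    pose A := kb * C0 * N0.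
    have A0 : 0 <= A by rewrite !mulr_ge0// ltW.
    have : `|z b i ord0 - z 0 i ord0| <=
        (- (A / lam)) * expR (- lam * b) - (- (A / lam)) * expR (- lam * 0).
      apply: (@derive_dist_end _ (fun t => z t i ord0) (fun t => (BB^T *m v t) i ord0)
        (fun t => (- (A / lam)) * expR (- lam * t))
        (fun t => (- (A / lam)) * (- lam) * expR (- lam * t))) => //.
      - exact: cvg_expRZ.
      - move=> t /andP[t0 tb].
        have [_ fz _] : flow_at t v z muh.
          apply: fl => //; first by apply: le_lt_trans bT; rewrite lee_fin.
          by apply: Hb; rewrite (ltW t0).
        exact: fz.
      - by move=> t _; exact: is_derive_expRZ.
      - move=> t /andP[t0 tb]; apply: le_trans (coord_le_enorm _ _) _.
        apply: le_trans (kbP _) _.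
        have -> : - (A / lam) * - lam * expR (- lam * t) = kb * (C0 * expR (- lam * t) * N0).
          by rewrite /A; field; rewrite gt_eqF.
        rewrite ler_wpM2l//; apply: le_trans (decs t _); last by rewrite (ltW t0).
        exact: enorm_colu.
    rewrite mulr0 expR0 mulr1 opprK => h; apply: le_trans h _.
    have : 0 <= A / lam * expR (- lam * b).
      by rewrite mulr_ge0 ?expR_ge0// divr_ge0// ltW.
    have -> : kb * C0 / lam * N0 = A / lam by rewrite /A; field; rewrite gt_eqF.
    lra.
  have Nb : state_norm (v b) (z b) (muh b) <= C0 * K4 * delta.
    have h := decs b; rewrite lexx b0 in h; apply: le_trans (h isT) _.
    have : expR (- lam * b) <= 1.
      by rewrite -expR0 ler_expR mulNr oppr_le0 mulr_ge0// ltW.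
    move=> E1; rewrite -!mulrA ler_wpM2l ?(ltW C00)//.
    apply: le_trans N0K; by rewrite ler_piMl.
  have zb : enorm (z b - zs) <= (1 + K3 * K4) * delta.
    have -> : z b - zs = (z b - z 0) + (z 0 - zs) by rewrite addrA subrK.
    apply: le_trans (enormD _ _) _.
    have := ler_wpM2l K30 N0K; move: zmove z0; lra.
  have p1 : dot (v b) (v b) + dot (muh b - mu) (muh b - mu) <= (C0 * K4 * delta) ^+ 2.
    apply: (@le_trans _ _ (state_norm (v b) (z b) (muh b) ^+ 2)).
      rewrite enorm_sqr !dot_col_mx; have := dot_ge0 (err zs (z b)); lra.
    by rewrite ler_pXn2r ?nnegrE ?enorm_ge0// !mulr_ge0// ltW.
  have p2 : dot (z b - zs) (z b - zs) <= ((1 + K3 * K4) * delta) ^+ 2.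
    rewrite -enorm_sqr ler_pXn2r ?nnegrE ?enorm_ge0// mulr_ge0 ?(ltW delta0)//.
    by rewrite addr_ge0// mulr_ge0.
  rewrite /phi /sqdist; apply: le_lt_trans K5d; rewrite /K5 mulrDl -!exprMn; lra.
have phi0 : phi 0 < rho2.
    apply: le_lt_trans K5d.
    have p1 : dot (v 0) (v 0) + dot (muh 0 - mu) (muh 0 - mu) <= N0 ^+ 2.
      rewrite enorm_sqr !dot_col_mx; have := dot_ge0 (err zs (z 0)); lra.
    have p2 : dot (z 0 - zs) (z 0 - zs) <= delta ^+ 2.
      by rewrite -enorm_sqr ler_pXn2r ?nnegrE ?enorm_ge0// ltW.
    have p3 : N0 ^+ 2 <= (K4 * delta) ^+ 2.
      by rewrite ler_pXn2r ?nnegrE// mulr_ge0// ltW.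
    have C01 : 1 <= C0.
      by rewrite /C0 lerDr divr_ge0 ?mulr_ge0// ltW.
    have p4 : (K4 * delta) ^+ 2 <= (C0 * (K4 * delta)) ^+ 2.
      have d4 : 0 <= K4 * delta by rewrite mulr_ge0// ltW.
      by rewrite ler_pXn2r ?nnegrE ?(mulr_ge0 (ltW C00) d4)// ler_peMl.
    have p5 : delta ^+ 2 <= ((1 + K3 * K4) * delta) ^+ 2.
      have K34 : 0 <= K3 * K4 by rewrite mulr_ge0.
      have d0 := ltW delta0; have := mulr_ge0 K34 d0 => h.
      rewrite mulrDl mul1r ler_pXn2r ?nnegrE ?lerDl//.
      by rewrite addr_ge0.
    rewrite /phi /sqdist /K5 mulrDl -!exprMn -(mulrA C0); lra.
move=> t t0 tT.
have small : forall s : R, 0 <= s -> (s%:E < T)%E -> phi s < rho2.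
  apply: continuity_induction => //.
    exact: phic.
  by move=> s s0 sT; have [h1 h2 h3] := cont s s0 sT; exact: phic.
split; first exact: small.
apply: dec => // s /andP[s0 st]; apply/ltW/small => //.
by apply: le_lt_trans tT; rewrite lee_fin.
Qed.

End Trajectories.

(** * Bounded Lipschitz functions *)

Section MaxMinLipschitz.
Variable R : realType.

Lemma max_lip (u a b : R) : `|Num.max u a - Num.max u b| <= `|a - b|.
Proof.
rewrite ler_norml; have := ler_norm (a - b); have := ler_norm (b - a).
rewrite [`|b - a|]distrC; case: (leP u a) => ?; case: (leP u b) => ? ? ?;
  apply/andP; split; lra.
Qed.

Lemma min_lip (u a b : R) : `|Num.min u a - Num.min u b| <= `|a - b|.
Proof.
rewrite ler_norml; have := ler_norm (a - b); have := ler_norm (b - a).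
rewrite [`|b - a|]distrC; case: (leP u a) => ?; case: (leP u b) => ? ? ?;
  apply/andP; split; lra.
Qed.

End MaxMinLipschitz.

Section BoundedLipschitz.
Variables (R : realType) (N : nat).

(** One constant serves as bound and as Lipschitz constant; this makes the class
    stable under products. *)
Definition bdlip (g : 'cV[R]_N -> R) :=
  exists2 M, 0 <= M & (forall x, `|g x| <= M) /\ forall x y, `|g x - g y| <= M * `|x - y|.

Definition bdlip_mx k l (g : 'cV[R]_N -> 'M[R]_(k, l)) := forall i j, bdlip (fun x => g x i j).

Lemma bdlip_cst (a : R) : bdlip (fun=> a).
Proof.
exists `|a| => //; split => // x y.
by rewrite subrr normr0 mulr_ge0.
Qed.

Lemma bdlipD f g : bdlip f -> bdlip g -> bdlip (fun x => f x + g x).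
Proof.
move=> [M M0 [fb fl]] [M' M0' [gb gl]]; exists (M + M'); first exact: addr_ge0.
split=> [x|x y]; first by apply: le_trans (ler_normD _ _) _; exact: lerD.
have -> : f x + g x - (f y + g y) = (f x - f y) + (g x - g y) by ring.
by apply: le_trans (ler_normD _ _) _; rewrite mulrDl lerD.
Qed.

Lemma bdlipM f g : bdlip f -> bdlip g -> bdlip (fun x => f x * g x).
Proof.
move=> [M M0 [fb fl]] [M' M0' [gb gl]]; exists (2 * (M * M')); first by rewrite !mulr_ge0.
split=> [x|x y].
  rewrite normrM; apply: (@le_trans _ _ (M * M')); first exact: ler_pM.
  by have := mulr_ge0 M0 M0'; lra.
have -> : f x * g x - f y * g y = (f x - f y) * g x + f y * (g x - g y) by ring.
apply: le_trans (ler_normD _ _) _; rewrite !normrM.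
have h1 : `|f x - f y| * `|g x| <= (M * `|x - y|) * M' by exact: ler_pM.
have h2 : `|f y| * `|g x - g y| <= M * (M' * `|x - y|) by exact: ler_pM.
by apply: le_trans (lerD h1 h2) _; rewrite le_eqVlt; apply/orP; left; apply/eqP; ring.
Qed.

Lemma bdlipN f : bdlip f -> bdlip (fun x => - f x).
Proof.
move=> [M M0 [fb fl]]; exists M => //; split=> [x|x y]; first by rewrite normrN.
by rewrite -opprD normrN.
Qed.

Lemma bdlip_ext f g : (forall x, f x = g x) -> bdlip f -> bdlip g.
Proof. by move=> fg; have -> : f = g by exact/funext. Qed.

Lemma bdlip_sum (I : finType) (f : I -> 'cV[R]_N -> R) :
  (forall i, bdlip (f i)) -> bdlip (fun x => \sum_i f i x).
Proof.
move=> fB; elim: (index_enum I) => [|i s IH].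
  by apply: bdlip_ext (bdlip_cst 0) => x; rewrite big_nil.
by apply: bdlip_ext (bdlipD (fB i) IH) => x; rewrite big_cons.
Qed.

Lemma bdlip_mx_cst k l (A : 'M[R]_(k, l)) : bdlip_mx (fun=> A).
Proof. by move=> i j; exact: bdlip_cst. Qed.

Lemma bdlip_mxD k l (f g : _ -> 'M[R]_(k, l)) : bdlip_mx f -> bdlip_mx g -> bdlip_mx (fun x => f x + g x).
Proof. by move=> fB gB i j; apply: bdlip_ext (bdlipD (fB i j) (gB i j)) => x; rewrite mxE. Qed.

Lemma bdlip_mxN k l (f : _ -> 'M[R]_(k, l)) : bdlip_mx f -> bdlip_mx (fun x => - f x).
Proof. by move=> fB i j; apply: bdlip_ext (bdlipN (fB i j)) => x; rewrite mxE. Qed.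

Lemma bdlip_mxM k l p (f : _ -> 'M[R]_(k, l)) (g : _ -> 'M[R]_(l, p)) :
  bdlip_mx f -> bdlip_mx g -> bdlip_mx (fun x => f x *m g x).
Proof.
move=> fB gB i j.
apply: (@bdlip_ext (fun x => \sum_a f x i a * g x a j)) => [x|]; first by rewrite mxE.
by apply: bdlip_sum => a; exact: bdlipM.
Qed.

Lemma bdlip_mxZ k l (a : R) (f : _ -> 'M[R]_(k, l)) : bdlip_mx f -> bdlip_mx (fun x => a *: f x).
Proof.
by move=> fB i j; apply: bdlip_ext (bdlipM (bdlip_cst a) (fB i j)) => x; rewrite mxE.
Qed.

Lemma bdlip_mx_col k l p (f : _ -> 'M[R]_(k, p)) (g : _ -> 'M[R]_(l, p)) :
  bdlip_mx f -> bdlip_mx g -> bdlip_mx (fun x => col_mx (f x) (g x)).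
Proof.
move=> fB gB i j; rewrite -(splitK i); case: (fintype.split i) => i' /=.
  by apply: bdlip_ext (fB i' j) => x; rewrite col_mxEu.
by apply: bdlip_ext (gB i' j) => x; rewrite col_mxEd.
Qed.

Lemma bdlip_mx_Dmx k m (f : _ -> 'cV[R]_(k * m)) : bdlip_mx f -> bdlip_mx (fun x => Dmx (f x)).
Proof.
move=> fB i j.
case E : ((mxtens_unindex i).1 == j).
  apply: bdlip_ext (fB (mxtens_index (j, (mxtens_unindex i).2)) ord0) => x.
  by rewrite !mxE E.
by apply: bdlip_ext (bdlip_cst 0) => x; rewrite mxE E.
Qed.

Lemma bdlip_mx_err k m (zs : 'cV[R]_(k * m)) (f : _ -> 'cV[R]_(k * m)) :
  bdlip_mx f -> bdlip_mx (fun x => err zs (f x)).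
Proof.
move=> fB i j; rewrite (ord1 j).
apply: (@bdlip_ext (fun x => \sum_b f x (mxtens_index (i, b)) ord0 * f x (mxtens_index (i, b)) ord0
   + - dot (blk zs i) (blk zs i))) => [x|].
  by rewrite errE; congr (_ + _); apply: eq_bigr => b _; rewrite !mxE.
by apply: bdlipD; [apply: bdlip_sum => b; exact: bdlipM|exact: bdlip_cst].
Qed.

Definition clip (a x : 'cV[R]_N) : 'cV[R]_N :=
  \col_i Num.max (a i ord0 - 1) (Num.min (a i ord0 + 1) (x i ord0)).

Lemma bdlip_mx_clip (a : 'cV[R]_N) : bdlip_mx (clip a).
Proof.
move=> i j; exists (`|a i ord0| + 1); first by rewrite addr_ge0.
have nle := ler_norm (a i ord0); have nle2 := ler_norm (- a i ord0); rewrite normrN in nle2.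
have n0 := normr_ge0 (a i ord0).
split=> [x|x y]; rewrite !mxE.
  rewrite ler_norml; case: (leP (a i ord0 + 1)) => ?; case: (leP (a i ord0 - 1)) => ?; apply/andP; split; lra.
have xy : `|x i ord0 - y i ord0| <= `|x - y|.
  by have := le_mx_norm (x - y) i ord0; rewrite !mxE.
apply: (@le_trans _ _ `|x - y|); last by rewrite ler_peMl//; lra.
by apply: le_trans xy; apply: le_trans (max_lip _ _ _) _; exact: min_lip.
Qed.

(** The truncation box contains the unit ball around a, and trapped trajectories stay
    in that ball. *)
Lemma clip_id (a x : 'cV[R]_N) : dot (x - a) (x - a) <= 1 -> clip a x = x.
Proof.
move=> xa; apply/colP => i; rewrite mxE.
have : `|(x - a) i ord0| <= 1.
  apply: le_trans (coord_le_enorm _ _) _.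
  by rewrite enorm_le// expr1n.
rewrite !mxE ler_norml => /andP[h1 h2].
by rewrite min_r ?max_r//; lra.
Qed.

Lemma picard_bdlip (f : 'cV[R]_N -> 'cV[R]_N) (x0 : 'cV[R]_N) : bdlip_mx f ->
  exists X : R -> 'cV[R]_N,
    X 0 = x0 /\ forall t : R, 0 <= t -> coord_derive t X (f (X t)).
Proof.
move=> fB.
have /choice[M MP] : forall i, exists M, [/\ 0 <= M, (forall x, `|f x i ord0| <= M) &
    forall x y, `|f x i ord0 - f y i ord0| <= M * `|x - y|].
  by move=> i; have [M M0 [h1 h2]] := fB i ord0; exists M.
pose L := \sum_i M i + 1.
have ML i : M i <= L.
  rewrite /L (bigD1 i)//= -addrA lerDl addr_ge0// sumr_ge0// => j _.
  by have [] := MP j.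
have L0 : 0 < L.
  by rewrite /L ltr_wpDl// sumr_ge0// => j _; have [] := MP j.
have [X [X0 dX]] : exists X : R -> 'cV[R]_N,
    X 0 = x0 /\ forall t : R, 0 <= t -> is_derive t 1 X (f (X t)).
  apply: (@picard _ _ f L L x0 L0) => [x|x y].
    apply/mx_norm_leP; first exact: ltW.
    move=> i j; rewrite (ord1 j); apply: le_trans (ML i).
    by have [_ H _] := MP i; exact: H.
  apply/mx_norm_leP; first by rewrite mulr_ge0// ltW.
  move=> i j; rewrite (ord1 j) !mxE.
  have [_ _ H] := MP i; apply: le_trans (H x y) _.
  by rewrite ler_wpM2r.
by exists X; split => // t t0; apply/coord_deriveP; exact: dX.
Qed.

End BoundedLipschitz.

(** * Symmetry, invariance and existence of motions *)

Section Motions.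
Variables (R : realType) (n nE m : nat) (G : graph n nE).
Notation BB := (ovl m (incidence R G)).
Notation SS1 := (ovl m (S1mx R G)).
Variables (zs : 'cV[R]_(nE * m)) (mu : 'cV[R]_nE) (kappa : R).

(** The closed loop with e eliminated: e = err zs z. *)
Definition motion (T : \bar R) (v : R -> 'cV[R]_(n * m)) (z : R -> 'cV[R]_(nE * m))
    (muh : R -> 'cV[R]_nE) :=
  right_cont v z muh /\
  forall t : R, 0 < t -> (t%:E < T)%E -> flow_at G zs mu kappa t v z muh.

Lemma solution_motion T v z e muh : is_solution G zs mu kappa T v z e muh ->
  motion T v z muh.
Proof.
move=> [_ eE [cv cz cm] H]; split.
  by split; apply/coord_cvgP.
move=> t t0 tT; have [fv fz _ fm] := H t t0 tT.
have eEt := eE t (ltW t0) tT; rewrite eEt in fv fm.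
split; [by apply/coord_deriveP|by apply/coord_deriveP|].
move=> k; rewrite !mxE; have := fm k; rewrite !mxE; exact: id.
Qed.

Lemma motion_solution T v z muh : (exists p0, z 0 = relpos G p0) -> motion T v z muh ->
  is_solution G zs mu kappa T v z (fun t => err zs (z t)) muh.
Proof.
move=> z0 [[cv cz cm] H]; split => //; first by split; apply/coord_cvgP.
move=> t t0 tT; have [fv fz fm] := H t t0 tT; split.
- by apply/coord_deriveP.
- by apply/coord_deriveP.
- by rewrite -mulmxA; apply/coord_deriveP; exact: coord_derive_err.
- by move=> k; have := fm k; rewrite !mxE.
Qed.

Lemma vfield_brot (Q : 'M[R]_m) v z muh : Q^T *m Q = 1%:M ->
  vfield G zs mu (brot n Q *m v) (brot nE Q *m z) muh = brot n Q *m vfield G zs mu v z muh.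
Proof.
move=> QQ; rewrite /vfield Dmx_brot err_brot// !mulmxA !ovl_brot.
by rewrite !mulmxBr mulmxN !mulmxA.
Qed.

(** The closed loop commutes with rotations. *)
Lemma motion_brot (Q : 'M[R]_m) T v z muh : Q^T *m Q = 1%:M -> motion T v z muh ->
  motion T (fun t => brot n Q *m v t) (fun t => brot nE Q *m z t) muh.
Proof.
move=> QQ [[cv cz cm] H]; split.
  by split => //; exact: coord_cvg_mulmx.
move=> t t0 tT; have [fv fz fm] := H t t0 tT; split.
- by rewrite vfield_brot//; exact: coord_derive_mulmx.
- by rewrite mulmxA ovl_tr ovl_brot -mulmxA -ovl_tr; exact: coord_derive_mulmx.
- by rewrite err_brot.
Qed.

Lemma state_norm_brot (Q : 'M[R]_m) (v : 'cV[R]_(n * m)) z muh : Q^T *m Q = 1%:M ->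
  state_norm zs mu (brot n Q *m v) (brot nE Q *m z) muh = state_norm zs mu v z muh.
Proof.
by move=> QQ; apply: enorm_dot; rewrite !dot_col_mx dot_brot// err_brot.
Qed.

Lemma state_norm_le (v : 'cV[R]_(n * m)) z muh : enorm v <= 1 -> enorm (z - zs) <= 1 -> enorm (muh - mu) <= 1 ->
  state_norm zs mu v z muh <= 2 + (2 * enorm zs + 1).
Proof.
move=> v1 z1 m1.
apply: le_trans (enorm_col_le _ _) _; have := enorm_col_le (err zs z) (muh - mu).
have h := err_le z1.
have h2 : (2 * enorm zs + 1) * enorm (z - zs) <= 2 * enorm zs + 1.
  by rewrite ler_piMr//; have := enorm_ge0 zs; lra.
by lra.
Qed.

(** Linear forms that vanish on the relative positions are constant along a
    motion. *)
Lemma motion_range T v z muh : (exists p, z 0 = relpos G p) -> motion T v z muh ->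
  forall t : R, 0 <= t -> (t%:E < T)%E -> exists p, z t = relpos G p.
Proof.
move=> [p0 z0] [[_ cz _] H] t t0 tT.
(* the rows of D span the linear forms that vanish on the range of relpos *)
pose D := (cokermx BB)^T.
have DB : D *m BB^T = 0 by rewrite -trmx_mul mulmx_coker trmx0.
have Dz : D *m z t = 0.
  have D0 : D *m z 0 = 0 by rewrite z0 /relpos mulmxA DB mul0mx.
  rewrite -D0; apply/colP => i; apply/eqP; rewrite -subr_eq0 -normr_le0.
  have : `|(D *m z t) i ord0 - (D *m z 0) i ord0| <= 0 - 0 :> R.
    apply: (@derive_dist_end _ (fun t => (D *m z t) i ord0) (fun=> 0) (fun=> 0) (fun=> 0)) => //.
    - exact: (@coord_cvg_mulmx _ _ _ _ _ D _ _ cz i).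
    - exact: cvg_cst.
    - move=> s /andP[s0 st].
      have sT : (s%:E < T)%E by apply: le_lt_trans tT; rewrite lee_fin.
      have [_ fz _] := H s s0 sT.
      by have := coord_derive_mulmx D fz i; rewrite mulmxA DB mul0mx mxE.
    - by move=> s _; rewrite normr0.
  by rewrite subrr.
have : ((z t)^T <= BB)%MS.
  by rewrite submxE; apply/eqP/trmx_inj; rewrite trmx_mul trmxK trmx0.
move/submxP => [w wE]; exists w^T.
by rewrite /relpos -trmx_mul -wE trmxK.
Qed.

(** Solutions of the truncated system are defined for all times, and obey the closed
    loop as long as they are in the unit ball around the equilibrium. *)
Lemma clipped_motion (v0 : 'cV[R]_(n * m)) (z0 : 'cV[R]_(nE * m)) (muh0 : 'cV[R]_nE) :
  exists v z muh, [/\ v 0 = v0, z 0 = z0 & muh 0 = muh0] /\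
   forall t : R, 0 <= t ->
    [/\ coord_cvg (nbhs t) v (v t), coord_cvg (nbhs t) z (z t) & coord_cvg (nbhs t) muh (muh t)] /\
    (sqdist zs mu (v t) (z t) (muh t) <= 1 -> flow_at G zs mu kappa t v z muh).
Proof.
pose a : 'cV[R]_(n * m + (nE * m + nE)) := col_mx 0 (col_mx zs mu).
pose pv (x : 'cV[R]_(n * m + (nE * m + nE))) : 'cV[R]_(n * m) := usubmx x.
pose pz (x : 'cV[R]_(n * m + (nE * m + nE))) : 'cV[R]_(nE * m) := usubmx (dsubmx x).
pose pm (x : 'cV[R]_(n * m + (nE * m + nE))) : 'cV[R]_nE := dsubmx (dsubmx x).
pose F x := col_mx (vfield G zs mu (pv x) (pz x) (pm x))
  (col_mx (BB^T *m pv x) (kappa *: (err zs (pz x) + mu - pm x))).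
have cB := bdlip_mx_clip a.
have vB : bdlip_mx (fun x => pv (clip a x)).
  by move=> i j; apply: bdlip_ext (cB (lshift _ i) j) => x; rewrite [RHS]mxE.
have zB : bdlip_mx (fun x => pz (clip a x)).
  by move=> i j; apply: bdlip_ext (cB (rshift _ (lshift _ i)) j) => x; rewrite [RHS]mxE [RHS]mxE.
have mB : bdlip_mx (fun x => pm (clip a x)).
  by move=> i j; apply: bdlip_ext (cB (rshift _ (rshift _ i)) j) => x; rewrite [RHS]mxE [RHS]mxE.
have FB : bdlip_mx (fun x => F (clip a x)).
  apply: bdlip_mx_col; last apply: bdlip_mx_col.
  - apply: bdlip_mxD; first apply: bdlip_mxD; try (apply: bdlip_mxN); rewrite //.
      apply: bdlip_mxM; last exact: bdlip_mx_err.
      by apply: bdlip_mxM; [exact: bdlip_mx_cst|exact: bdlip_mx_Dmx].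
    apply: bdlip_mxM; last by apply: bdlip_mxD; [exact: bdlip_mx_cst|exact: bdlip_mxN].
    by apply: bdlip_mxM; [exact: bdlip_mx_cst|exact: bdlip_mx_Dmx].
  - by apply: bdlip_mxM; first exact: bdlip_mx_cst.
  - apply: bdlip_mxZ; apply: bdlip_mxD; last exact: bdlip_mxN.
    by apply: bdlip_mxD; [exact: bdlip_mx_err|exact: bdlip_mx_cst].
have [X [X0 dX]] := picard_bdlip (col_mx v0 (col_mx z0 muh0)) FB.
exists (fun t => pv (X t)), (fun t => pz (X t)), (fun t => pm (X t)); split.
  by rewrite X0 /pv /pz /pm !col_mxKd !col_mxKu.
move=> t t0; have Xt := dX t t0.
have cX := coord_derive_cvg Xt.
split.
  split=> i.
  - by rewrite mxE; under eq_cvg do rewrite mxE; exact: cX.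
  - by rewrite mxE mxE; under eq_cvg do rewrite mxE mxE; exact: cX.
  - by rewrite mxE mxE; under eq_cvg do rewrite mxE mxE; exact: cX.
move=> near.
have cid : clip a (X t) = X t.
  apply: clip_id; have -> : X t = col_mx (pv (X t)) (col_mx (pz (X t)) (pm (X t))).
    by rewrite /pz /pm /pv !vsubmxK.
  rewrite /a opp_col_mx opp_col_mx add_col_mx add_col_mx subr0 !dot_col_mx addrA.
  exact: near.
rewrite cid in Xt; split=> i.
- have := Xt (lshift _ i); rewrite col_mxEu => H.
  by apply: is_derive_ext H _ (erefl _) => s; rewrite mxE.
- have := Xt (rshift _ (lshift _ i)); rewrite col_mxEd col_mxEu => H.
  by apply: is_derive_ext H _ (erefl _) => s; rewrite mxE mxE.
- have := Xt (rshift _ (rshift _ i)); rewrite col_mxEd col_mxEd => H.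
  by apply: is_derive_ext H _ (erefl _) => s; rewrite mxE mxE.
Qed.

End Motions.

(** * Local exponential stability *)

(** The theorem for initial data near the point zs of the orbit.  The radius rho2 is
    chosen below that of the Lyapunov estimate, and below that of shape_dist so that
    the decay of e turns into convergence of z to the shape. *)
Lemma stable_near_zs (R : realType) (m n nE : nat) (G : graph n nE)
    (ps : 'cV[R]_(n * m)) (mu : 'cV[R]_nE) :
  (2 <= n)%N -> inf_min_rigid G ps -> hurwitz (Fmx G (relpos G ps)) ->
  exists kappas : R, 0 < kappas /\ forall kappa : R, kappas < kappa ->
  exists delta C c : R, [/\ 0 < delta, 0 < C, 0 < c &
    forall (v0 : 'cV[R]_(n * m)) (p0 : 'cV[R]_(n * m)) (muh0 : 'cV[R]_nE),
    enorm v0 < delta -> enorm (muh0 - mu) < delta ->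
    enorm (relpos G p0 - relpos G ps) < delta ->
    (exists v z muh, motion G (relpos G ps) mu kappa +oo%E v z muh /\
       [/\ v 0 = v0, z 0 = relpos G p0 & muh 0 = muh0]) /\
    (forall (T : \bar R) v z muh, motion G (relpos G ps) mu kappa T v z muh ->
       [/\ v 0 = v0, z 0 = relpos G p0 & muh 0 = muh0] ->
       forall t : R, 0 <= t -> (t%:E < T)%E ->
         state_norm (relpos G ps) mu (v t) (z t) (muh t) <=
           C * expR (- c * t) * state_norm (relpos G ps) mu (v 0) (z 0) (muh 0) /\
         exists2 w, desired_shape (relpos G ps) w &
           enorm (z t - w) <= C * expR (- c * t))].
Proof.
move=> n2 rig hF; set zs := relpos G ps.
have [kappas [kappas0 H]] := lyap_estimate hF.
exists kappas; split => // kappa hk.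
have [P [lam [rho [c1 [c2 [PT [lam0 rho0 rho1 c10 c20] Vequiv Vdecr]]]]]] := H kappa hk.
have [K [r [K0 r0 Hdist]]] := shape_dist n2 rig.
pose rho2 := Num.min (rho ^+ 2) (r ^+ 2).
have rho20 : 0 < rho2 by rewrite lt_min !exprn_gt0.
have rho2r : rho2 <= rho ^+ 2 by rewrite ge_min lexx.
have rho21 : rho2 <= 1.
  by apply: le_trans rho2r _; rewrite expr_le1// ltW.
have [delta [delta0 delta1 trap]] :=
  trapped mu PT lam0 rho0 c10 c20 Vequiv Vdecr rho20 rho2r.
set C0 := 9 * c2 / c1 + 1 in trap.
have C00 : 0 < C0 by rewrite ltr_wpDl// divr_ge0 ?mulr_ge0// ltW.
pose K4 : R := 2 + (2 * enorm zs + 1).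
have K40 : 0 < K4 by rewrite /K4; have := enorm_ge0 zs; lra.
pose C := C0 + K * C0 * K4.
have KCK : 0 < K * C0 * K4 by rewrite !mulr_gt0.
exists delta, C, lam; split => //; first by rewrite addr_gt0.
move=> v0 p0 muh0 hv hm hz; split.
  have [v [z [muh [[v0E z0E m0E] near]]]] := clipped_motion G zs mu kappa v0 (relpos G p0) muh0.
  exists v, z, muh; split => //.
  have rc : right_cont v z muh.
    have [[cv cz cm] _] := near 0 (lexx 0).
    by split=> i; apply: cvg_at_right_filter; [exact: cv|exact: cz|exact: cm].
  split => // t t0 tT; apply: (near t (ltW t0)).2.
  apply: (le_trans _ rho21); apply: ltW.
  apply: (trap +oo%E v z muh _ _ _ _ _ _ t (ltW t0) tT).1 => //.
  - by move=> s s0 _; exact: (near s (ltW s0)).1.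
  - move=> s s0 _ hs; apply: (near s (ltW s0)).2; exact: le_trans hs rho21.
  - by rewrite v0E.
  - by rewrite z0E.
  - by rewrite m0E.
move=> T v z muh mot [v0E z0E m0E] t t0 tT.
have [rc fl] := mot.
have [sq decay] : sqdist zs mu (v t) (z t) (muh t) < rho2 /\
    state_norm zs mu (v t) (z t) (muh t) <=
      C0 * expR (- lam * t) * state_norm zs mu (v 0) (z 0) (muh 0).
  apply: (trap T v z muh) => //; rewrite ?v0E ?z0E ?m0E//.
    move=> s s0 sT; have [fv fz fm] := fl s s0 sT.
    by split; exact: coord_derive_cvg.
  by move=> s s0 sT _; exact: fl.
have N00 : 0 <= state_norm zs mu (v 0) (z 0) (muh 0) by exact: enorm_ge0.
have E0 : 0 < expR (- lam * t) by exact: expR_gt0.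
split.
  apply: le_trans decay _; apply: ler_wpM2r => //; apply: ler_wpM2r; first exact: ltW.
  by rewrite lerDl ltW.
have [p zp] : exists p, z t = relpos G p.
  by apply: (motion_range (T := T) _ mot) => //; exists p0.
have zr : enorm (relpos G p - zs) <= r.
  rewrite -zp enorm_le ?(ltW r0)//; apply: (@le_trans _ _ rho2); last by rewrite ge_min lexx orbT.
  apply: le_trans (ltW sq); rewrite /sqdist.
  by have := dot_ge0 (v t); have := dot_ge0 (muh t - mu); lra.
have zsS : desired_shape zs zs.
  exists 1%:M; last by rewrite [tensmx _ _]brot1 mul1mx.
  by split; rewrite ?trmx1 ?mulmx1 ?det1.
have [w wS wd] := Hdist p zs zsS zr.
exists w => //; rewrite zp; apply: le_trans wd _.
have e1 : enorm (err zs (relpos G p)) <= state_norm zs mu (v t) (z t) (muh t).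
  by rewrite -zp /state_norm; apply: le_trans (enorm_cold _ _); exact: enorm_colu.
have N0K : state_norm zs mu (v 0) (z 0) (muh 0) <= K4.
  by apply: state_norm_le; rewrite ?v0E ?z0E ?m0E ltW// (lt_le_trans _ delta1).
have h1 : C0 * expR (- lam * t) * state_norm zs mu (v 0) (z 0) (muh 0) <=
    C0 * expR (- lam * t) * K4.
  by rewrite ler_wpM2l// mulr_ge0// ltW.
have h2 := ler_wpM2l (ltW K0) (le_trans e1 (le_trans decay h1)).
apply: le_trans h2 _; rewrite /C [leRHS]mulrDl.
have -> : K * (C0 * expR (- lam * t) * K4) = K * C0 * K4 * expR (- lam * t) by ring.
by rewrite lerDr mulr_ge0// ltW.
Qed.

(** If the initial relative positions are near w = Q zs, the rotation by Q^T moves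
    them near zs; both the solution found there and the estimates are rotated
    back by Q. *)
Theorem mainTheorem4 (R : realType) (m n nE : nat) (G : graph n nE)
    (ps : 'cV[R]_(n * m)) (zs : 'cV[R]_(nE * m)) (mu : 'cV[R]_nE) :
  m = 2%N \/ m = 3%N ->
  (2 <= n)%N ->
  inf_min_rigid G ps ->
  zs = relpos G ps ->
  hurwitz (Fmx G zs) ->
  exists kappas : R, 0 < kappas /\
    forall kappa : R, kappas < kappa -> loc_exp_stable G zs mu kappa.
Proof.
move=> _ n2 rig zsE hF; rewrite zsE in hF.
have [kappas [kappas0 H]] := stable_near_zs mu n2 rig hF.
exists kappas; split => // kappa hk.
have [delta [C [c [delta0 C0 c0 S]]]] := H kappa hk.
exists delta, C, c; split => // v0 p0 muh0 hv hm [w [Q oQ wE] zw].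
rewrite -zsE in S.
have QQ := orth_trmxK oQ.1.
have QQt : Q^T^T *m Q^T = 1%:M by rewrite trmxK; exact: oQ.1.
have hv' : enorm (brot n Q^T *m v0) < delta by rewrite enorm_brot.
have hz' : enorm (relpos G (brot n Q^T *m p0) - zs) < delta.
  rewrite -(enorm_brot _ QQ) mulmxBr -relpos_brot.
  by rewrite -{1}[Q]trmxK brotK// -[brot nE Q *m zs]wE.
have [[v [z [muh [mot [v0E z0E m0E]]]]] St] := S _ _ _ hv' hm hz'.
have QKn (x : 'cV[R]_(n * m)) : brot n Q *m (brot n Q^T *m x) = x.
  by rewrite -{1}[Q]trmxK brotK.
split.
  have mot' := motion_brot QQ mot.
  have z0' : brot nE Q *m z 0 = relpos G p0 by rewrite z0E -relpos_brot QKn.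
  exists (fun t => brot n Q *m v t), (fun t => brot nE Q *m z t).
  exists (fun t => err zs (brot nE Q *m z t)), muh; split.
    by apply: motion_solution mot'; exists p0.
  by split => //; rewrite v0E QKn.
move=> {v z muh mot v0E z0E m0E} T v z e muh sol [v0E z0E m0E] t t0 tT.
have mot := motion_brot QQt (solution_motion sol).
have eE s : 0 <= s -> (s%:E < T)%E -> e s = err zs (z s) by case: sol => _ eE _ _; exact: eE.
have T0 : (0%:E < T)%E by apply: le_lt_trans tT; rewrite lee_fin.
have [|h1 [w' [Q' oQ' w'E] w'd]] := St T _ _ _ mot _ t t0 tT.
  by split; rewrite ?v0E ?z0E ?relpos_brot.
split.
  by rewrite !state_norm_brot// in h1; rewrite (eE t)// (eE 0).
exists (brot nE Q *m w').
  exists (Q *m Q'); first exact: special_orthM.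
  by rewrite w'E mulmxA [brot nE Q *m _]brotM.
apply: le_trans w'd; rewrite -(enorm_brot (z t - brot nE Q *m w') QQt).
by rewrite mulmxBr brotK.
Qed.
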